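(* Let $\mathcal{G}_1$ and $\mathcal{G}_2$ be two isomorphic, asymmetric and friendly weighted undirected graphs with adjacency matrices $\mathbf{A}$ and $\mathbf{B}$, and let $\mathbf{\Pi}^*$ be the unique permutation matrix with $\mathbf{A}=(\mathbf{\Pi}^{*})^\top\mathbf{B}\mathbf{\Pi}^*$. Let the interaction graph $\mathcal{H}$ be undirected and connected. Then every trajectory $\mathbf{Q}(t)$ of the system (D) given in the context, with an initial condition $\mathbf{Q}(0)$ such that $\mathbf{P}_i(0)\in\mathcal{D}_n$ for all $i$ (and all other components of $\mathbf{Q}(0)$ arbitrary), converges as $t\to\infty$ to an equilibrium of (D). In addition, $\mathbf{P}_i(t)\to\mathbf{\Pi}^*$ as $t\to\infty$ for all $i=1,\dots,n$, and there is a finite time $T>0$ such that for all $t\ge T$ and all $i=1,\dots,n$ one has $\|\mathbf{P}_i(t)-\mathbf{\Pi}^*\|_F<1/2$ and the orthogonal projection of $\mathbf{P}_i(t)$ onto the set $\mathcal{P}$ of permutation matrices is identical to $\mathbf{\Pi}^*$.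
   Context: Graphs. $\mathcal{G}_1,\mathcal{G}_2$ are undirected weighted graphs on the vertex set $\{1,\dots,n\}$ with symmetric adjacency matrices $\mathbf{A},\mathbf{B}\in[0,\infty)^{n\times n}$; $\mathbf{a}_i,\mathbf{b}_i\in\mathbb{R}^n$ are the $i$th columns of $\mathbf{A},\mathbf{B}$. $\mathcal{P}$ is the set of $n\times n$ permutation matrices. $\mathcal{G}_1,\mathcal{G}_2$ are isomorphic if $\mathbf{A}=\mathbf{\Pi}^\top\mathbf{B}\mathbf{\Pi}$ for some $\mathbf{\Pi}\in\mathcal{P}$. A graph with adjacency matrix $\mathbf{A}$ is asymmetric if the only $\mathbf{\Pi}\in\mathcal{P}$ with $\mathbf{A}=\mathbf{\Pi}^\top\mathbf{A}\mathbf{\Pi}$ is the identity; two isomorphic asymmetric graphs are related by a unique permutation matrix. A graph is friendly if its adjacency matrix has $n$ distinct eigenvalues and none of its eigenvectors is orthogonal to $\mathbf{1}_n$ (the all-ones vector). Projections. $\mathcal{D}_n=\{\mathbf{P}\in\mathbb{R}^{n\times n}:\mathbf{P}\mathbf{1}_n=\mathbf{1}_n\}$, and $\mathrm{Proj}_{\mathcal{D}_n}(\mathbf{V}):=\mathbf{V}(\mathbf{I}_n-\frac1n\mathbf{1}_n\mathbf{1}_n^\top)$ for $\mathbf{V}\in\mathbb{R}^{n\times n}$. The orthogonal projection of a matrix $\mathbf{P}$ onto $\mathcal{P}$ is $\mathrm{argmax}_{\mathbf{\Pi}\in\mathcal{P}}\mathrm{tr}(\mathbf{\Pi}^\top\mathbf{P})$.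 $\|\cdot\|_F$ is the Frobenius norm. Agents. There are $n$ agents, with interaction graph $\mathcal{H}$ on $\{1,\dots,n\}$, undirected and connected, with weights $w_{ij}=w_{ji}>0$ if $(i,j)$ is an edge of $\mathcal{H}$ and $w_{ij}=w_{ji}=0$ otherwise. Agent $i$ has variables $\mathbf{P}_i,\mathbf{K}_i,\Theta_i,\Upsilon_i\in\mathbb{R}^{n\times n}$ and $\mathbf{y}_i,\mathbf{z}_i,\boldsymbol{\lambda}_i\in\mathbb{R}^n$; $\mathbf{Q}$ denotes the collection of all these variables over $i=1,\dots,n$. $[\mathbf{Y}]_i\in\mathbb{R}^{n\times n}$ is the matrix whose $i$th column is $\mathbf{y}_i$ and whose other columns are zero; $[\mathbf{Z}]^i\in\mathbb{R}^{n\times n}$ is the matrix whose $i$th row is $\mathbf{z}_i^\top$ and whose other rows are zero. $(\mathbf{M})_i^{\mathrm C}$ and $(\mathbf{M})_i^{\mathrm R}$ denote the $i$th column vector and $i$th row vector of $\mathbf{M}$. System (D): for all $i=1,\dots,n$, $$\dot{\mathbf{P}}_i=\mathrm{Proj}_{\mathcal{D}_n}\Big\{-(\mathbf{P}_i\mathbf{a}_i-\mathbf{y}_i)\mathbf{a}_i^\top-\mathbf{b}_i\boldsymbol{\lambda}_i^\top-\sum_{j=1}^nw_{ij}(\Theta_i-\Theta_j)-\sum_{j=1}^nw_{ij}(\mathbf{P}_i-\mathbf{P}_j)-\mathbf{b}_i(\mathbf{b}_i^\top\mathbf{P}_i-\mathbf{z}_i^\top)\Big\},$$ $$\dot{\boldsymbol{\lambda}}_i^\top=\mathbf{b}_i^\top\mathbf{P}_i-\mathbf{z}_i^\top,\qquad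 \dot{\Theta}_i=\sum_{j=1}^nw_{ij}(\mathbf{P}_i-\mathbf{P}_j),$$ $$\dot{\Upsilon}_i=[\mathbf{Y}]_i-[\mathbf{Z}]^i-\sum_{j=1}^nw_{ij}(\mathbf{K}_i-\mathbf{K}_j)-\sum_{j=1}^nw_{ij}(\Upsilon_i-\Upsilon_j),$$ $$\dot{\mathbf{y}}_i=(\mathbf{P}_i\mathbf{a}_i-\mathbf{y}_i)-(\Upsilon_i)_i^{\mathrm C},\qquad \dot{\mathbf{z}}_i^\top=\boldsymbol{\lambda}_i^\top+(\Upsilon_i)_i^{\mathrm R}+\mathbf{b}_i^\top\mathbf{P}_i-\mathbf{z}_i^\top,\qquad \dot{\mathbf{K}}_i=\sum_{j=1}^nw_{ij}(\Upsilon_i-\Upsilon_j).$$ *)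

(* Defs.v *)
From HB Require Import structures.
From mathcomp Require Import all_boot all_order all_algebra.
From mathcomp Require Import all_classical all_reals all_analysis.

Set Implicit Arguments.
Unset Strict Implicit.
Unset Printing Implicit Defensive.

Import Order.TTheory GRing.Theory Num.Theory.
Import numFieldNormedType.Exports.

Local Open Scope classical_set_scope.
Local Open Scope ring_scope.

Section Graphs.
Context {R : realType} {n : nat}.
Implicit Types A B Pi : 'M[R]_n.

Definition ones : 'cV[R]_n := const_mx 1.

(* Diagonal entries (self-loops) are allowed. *)
Definition is_adjacency A := A^T = A /\ forall i j, 0 <= A i j.

Definition is_isomorphism A B Pi := is_perm_mx Pi /\ A = Pi^T *m B *m Pi.

Definition isomorphic A B := exists Pi, is_isomorphism A B Pi.

Definition asymmetric A := forall Pi, is_isomorphism A A Pi -> Pi = 1%:M.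

(* Eigenvectors are row vectors, as in the library's [eigenvalue]; adjacency
   matrices being symmetric, left and right eigenvectors agree up to
   transposition. *)
Definition friendly A :=
  (exists2 e : 'I_n -> R, injective e & forall i, eigenvalue A (e i)) /\
  (forall (a : R) (v : 'rV[R]_n),
     v != 0 -> v *m A = a *: v -> v *m ones != 0).

(* The interaction graph: [H] is its edge relation, [w] its weights. *)
Definition is_connected_weighted_graph (H : rel 'I_n) (w : 'I_n -> 'I_n -> R) :=
  [/\ symmetric H,
      forall i j, connect H i j,
      forall i j, w i j = w j i,
      forall i j, H i j -> 0 < w i j
    & forall i j, ~~ H i j -> w i j = 0].

End Graphs.

Section Projections.
Context {R : realType} {n : nat}.
Implicit Types M V Pi : 'M[R]_n.

Definition Dn : set 'M[R]_n := [set M | M *m ones = ones].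

Definition projD V : 'M[R]_n :=
  V *m (1%:M - n%:R^-1 *: (ones *m ones^T)).

Definition frobenius_norm M : R := Num.sqrt (\sum_i \sum_j M i j ^+ 2).

(* The whole argmax set: projecting onto the permutation matrices gives [Pi]
   unambiguously when this set is [[set Pi]]. *)
Definition perm_projection M : set 'M[R]_n :=
  [set Pi | is_perm_mx Pi /\
     forall Pi', is_perm_mx Pi' -> \tr (Pi'^T *m M) <= \tr (Pi^T *m M)].

End Projections.

Record state (R : realType) (n : nat) := State {
  sP : 'I_n -> 'M[R]_n;
  sK : 'I_n -> 'M[R]_n;
  sTheta : 'I_n -> 'M[R]_n;
  sUpsilon : 'I_n -> 'M[R]_n;
  sy : 'I_n -> 'cV[R]_n;
  sz : 'I_n -> 'cV[R]_n;
  slambda : 'I_n -> 'cV[R]_n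
}.

Section System.
Context {R : realType} {n : nat}.
Implicit Types (A B : 'M[R]_n) (Q : state R n) (i : 'I_n).
Implicit Types (w : 'I_n -> 'I_n -> R) (X : 'I_n -> 'M[R]_n).

Definition only_col i (u : 'cV[R]_n) : 'M[R]_n :=
  \matrix_(r, c) (if c == i then u r 0 else 0).

Definition only_row i (u : 'cV[R]_n) : 'M[R]_n :=
  \matrix_(r, c) (if r == i then u c 0 else 0).

Definition disagreement w X i : 'M[R]_n := \sum_j w i j *: (X i - X j).

Definition res_y A Q i : 'cV[R]_n := sP Q i *m col i A - sy Q i.

Definition res_z B Q i : 'rV[R]_n := (col i B)^T *m sP Q i - (sz Q i)^T.

Definition system_D w A B Q : state R n := {|
  sP := fun i => projD (
          - (res_y A Q i *m (col i A)^T)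
          - col i B *m (slambda Q i)^T
          - disagreement w (sTheta Q) i
          - disagreement w (sP Q) i
          - col i B *m res_z B Q i);
  sK := fun i => disagreement w (sUpsilon Q) i;
  sTheta := fun i => disagreement w (sP Q) i;
  sUpsilon := fun i => only_col i (sy Q i) - only_row i (sz Q i)
          - disagreement w (sK Q) i
          - disagreement w (sUpsilon Q) i;
  sy := fun i => res_y A Q i - col i (sUpsilon Q i);
  sz := fun i => ((slambda Q i)^T + row i (sUpsilon Q i) + res_z B Q i)^T;
  slambda := fun i => (res_z B Q i)^T
|}.

Definition equilibrium w A B Q :=
  forall i,
    sP (system_D w A B Q) i = 0 /\
    sK (system_D w A B Q) i = 0 /\
    sTheta (system_D w A B Q) i = 0 /\
    sUpsilon (system_D w A B Q) i = 0 /\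
    sy (system_D w A B Q) i = 0 /\
    sz (system_D w A B Q) i = 0 /\
    slambda (system_D w A B Q) i = 0.

Definition state_cvg (Q : R -> state R n) (F : set_system R) (L : state R n) :=
  forall i,
    sP (Q t) i @[t --> F] --> sP L i /\
    sK (Q t) i @[t --> F] --> sK L i /\
    sTheta (Q t) i @[t --> F] --> sTheta L i /\
    sUpsilon (Q t) i @[t --> F] --> sUpsilon L i /\
    sy (Q t) i @[t --> F] --> sy L i /\
    sz (Q t) i @[t --> F] --> sz L i /\
    slambda (Q t) i @[t --> F] --> slambda L i.

Definition state_is_derive (Q : R -> state R n) (t : R) (V : state R n) :=
  forall i,
    is_derive t 1 (fun s => sP (Q s) i) (sP V i) /\
    is_derive t 1 (fun s => sK (Q s) i) (sK V i) /\
    is_derive t 1 (fun s => sTheta (Q s) i) (sTheta V i) /\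
    is_derive t 1 (fun s => sUpsilon (Q s) i) (sUpsilon V i) /\
    is_derive t 1 (fun s => sy (Q s) i) (sy V i) /\
    is_derive t 1 (fun s => sz (Q s) i) (sz V i) /\
    is_derive t 1 (fun s => slambda (Q s) i) (slambda V i).

(* A solution on [0, +oo[: right-continuous at 0 and satisfying the ODE at
   every t > 0 (the values at t < 0 are irrelevant). *)
Definition trajectory w A B (Q : R -> state R n) :=
  state_cvg Q 0^'+ (Q 0) /\
  forall t, 0 < t -> state_is_derive Q t (system_D w A B (Q t)).

End System.

(* Main.v *)
(* The system is a linear saddle flow X' = F X.  Because F is linear, the
   derivative of a solution and its difference from an equilibrium are again
   solutions.  As long as P 1 = 0, the squared norm of a solution decreases at the
   rate 2 q, where q sums the squared residuals P_i a_i - y_i, b_i^T P_i - z_i^T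
   and the disagreements of P and Upsilon.  The second derivative of the squared
   norm is bounded by the norms of F X and F (F X), so Barbalat's lemma gives
   q -> 0 along every solution; applied to X, F X and F (F X), this forces
   F X -> 0, with no spectral analysis of F.  A solution is bounded since an
   equilibrium exists (the Laplacian of a connected graph is onto the zero-sum
   vectors), it has a cluster point along an ultrafilter, that point is an
   equilibrium, and monotonicity of the distance to it turns clustering into
   convergence.  At an equilibrium with P_i 1 = 1 all P_i equal some P with
   P A = B P, so Pi*^T P commutes with A; it therefore acts as a scalar on each
   eigenvector v of A, and that scalar is 1 because v is not orthogonal to 1. *)
Require Import Defs.
From mathcomp Require Import all_boot all_order fingroup perm all_algebra.
From mathcomp Require Import all_classical all_reals all_analysis.
From mathcomp Require Import ring lra zify.
Import Order.TTheory GRing.Theory Num.Theory.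
Import numFieldNormedType.Exports.
Local Open Scope classical_set_scope.
Local Open Scope ring_scope.

(** * Real analysis on positive times: mean value estimates, Barbalat's lemma and a Landau-type
    inequality *)

Section RealFunctions.
Set Implicit Arguments.
Unset Strict Implicit.
Context {R : realType}.
Implicit Types (f df ddf : R -> R) (s t h u : R).

Lemma is_derive_lincomb (I : Type) (r : seq I) (g : I -> R)
    (x : I -> R -> R) (dx : I -> R) t :
  (forall i, is_derive t 1 (x i) (dx i)) ->
  is_derive t 1 (fun s => \sum_(i <- r) g i * x i s) (\sum_(i <- r) g i * dx i).
Proof.
move=> xD; elim: r => [|i r IHr].
  rewrite big_nil (_ : (fun _ => _) = cst 0); first exact: is_derive_cst.
  by apply/funext => s; rewrite big_nil.
rewrite big_cons (_ : (fun _ => _) =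
  (g i \*: x i) + (fun s => \sum_(j <- r) g j * x j s)).
  by apply: is_deriveD; exact: is_deriveZ.
by apply/funext => s; rewrite big_cons.
Qed.

Lemma is_derive_dot (I : Type) (r : seq I) (x y : I -> R -> R)
    (dx dy : I -> R) t :
  (forall i, is_derive t 1 (x i) (dx i)) ->
  (forall i, is_derive t 1 (y i) (dy i)) ->
  is_derive t 1 (fun s => \sum_(i <- r) x i s * y i s)
    (\sum_(i <- r) dx i * y i t + \sum_(i <- r) x i t * dy i).
Proof.
move=> xD yD; elim: r => [|i r IHr].
  rewrite !big_nil addr0 (_ : (fun _ => _) = cst 0); first exact: is_derive_cst.
  by apply/funext => s; rewrite big_nil.
rewrite !big_cons (_ : (fun _ => _) =
  (x i * y i) + (fun s => \sum_(j <- r) x j s * y j s)).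
  have /= dM := @is_deriveM _ _ _ _ _ _ _ _ (xD i) (yD i).
  rewrite addrACA; apply: is_deriveD.
  by apply: is_derive_eq; rewrite addrC; congr (_ + _); rewrite /GRing.scale/= mulrC.
by apply/funext => s; rewrite big_cons.
Qed.

Lemma mvt_pos f df s t : (forall u, 0 < u -> is_derive u 1 f (df u)) ->
  0 < s -> s < t -> exists2 c, s < c < t & f t - f s = df c * (t - s).
Proof.
move=> fD s0 st; have [||c] := @MVT _ f df s t st.
- by move=> x; rewrite in_itv/= => /andP[sx _]; apply: fD; exact: lt_trans sx.
- apply: derivable_within_continuous => x; rewrite in_itv/= => /andP[sx _].
  by have [] := fD x (lt_le_trans s0 sx).
by rewrite in_itv/= => cst fE; exists c.
Qed.

(** The mean value theorem makes [f] constant on positive times; as no derivative is given at 0, the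
    right limit there identifies the constant. *)
Lemma derive0_const f l : (forall u, 0 < u -> is_derive u 1 f 0) ->
  f t @[t --> 0^'+] --> l -> forall t, 0 < t -> f t = l.
Proof.
move=> fD fl.
have fE s t : 0 < s -> s < t -> f t = f s.
  move=> s0 st; have [c _] := mvt_pos fD s0 st.
  by rewrite mul0r => /eqP; rewrite subr_eq0 => /eqP.
move=> t t0; have cl : (f : R -> R) s @[s --> 0^'+] --> f t.
  apply: cvg_near_cst; exists t => //= s /=; rewrite sub0r normrN => st s0.
  rewrite gtr0_norm// in st.
  by rewrite (fE _ _ s0 st).
exact: (cvg_unique _ cl fl).
Qed.

Lemma derive_le0_anti f df : (forall u, 0 < u -> is_derive u 1 f (df u)) ->
  (forall u, 0 < u -> df u <= 0) -> forall s t, 0 < s -> s <= t -> f t <= f s.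
Proof.
move=> fD df0 s t s0; rewrite le_eqVlt => /predU1P[->//|st].
have [c /andP[sc _] fE] := mvt_pos fD s0 st.
rewrite -subr_le0 fE mulr_le0_ge0//; last by rewrite subr_ge0 ltW.
by apply: df0; exact: lt_trans sc.
Qed.

(** Two uses of the mean value theorem: [df] equals the difference quotient at some [c] in the
    window, and changes by at most [C * h] between [t] and [c]. The window length [h] is free:
    Barbalat's lemma takes it small, Landau's takes it large. *)
Lemma derive_bound f df ddf t h C :
  (forall u, 0 < u -> is_derive u 1 f (df u)) ->
  (forall u, 0 < u -> is_derive u 1 df (ddf u)) ->
  0 < t -> 0 < h -> (forall u, t <= u -> `|ddf u| <= C) ->
  `|df t| <= `|f (t + h) - f t| / h + C * h.
Proof.
move=> fD dfD t0 h0 ddfC.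
have tth : t < t + h by rewrite ltrDl.
have [c /andP[tc cth] fE] := mvt_pos fD t0 tth.
have [d /andP[td _] dfE] := mvt_pos dfD t0 tc.
have -> : `|f (t + h) - f t| / h = `|df c|.
  rewrite fE [t + h]addrC addrK normrM (gtr0_norm h0) mulfK//.
  by rewrite gt_eqF.
have C0 : 0 <= C by apply: le_trans (ddfC t _).
have -> : df t = df c - (df c - df t) by ring.
apply: le_trans (ler_normB _ _) _; rewrite lerD2l dfE normrM.
apply: ler_pM => //; first exact/ddfC/ltW.
rewrite gtr0_norm ?subr_gt0// lerBlDl; exact: ltW.
Qed.

(** A nonincreasing [f] bounded below eventually stays within any margin of its infimum, so its
    increments over a window of fixed length become negligible. *)
Lemma barbalat f df ddf C :
  (forall u, 0 < u -> is_derive u 1 f (df u)) ->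
  (forall u, 0 < u -> is_derive u 1 df (ddf u)) ->
  (forall u, 0 < u -> 0 <= f u) -> (forall u, 0 < u -> df u <= 0) ->
  (forall u, 1 <= u -> `|ddf u| <= C) ->
  df t @[t --> +oo] --> 0.
Proof.
move=> fD dfD f0 df0 ddfC; apply/cvgr0Pnorm_le => e e0.
have C0 : 0 <= C by apply: le_trans (ddfC 1 _).
(* Chosen so that [C * h <= e / 2]; adding 1 keeps the divisor positive when [C = 0]. *)
set h := e / 2 / (C + 1).
have h0 : 0 < h by rewrite !divr_gt0// ltr_wpDl.
have eh0 : 0 < e / 2 * h by rewrite mulr_gt0// divr_gt0.
have anti := derive_le0_anti fD df0.
pose A := [set f u | u in [set u | 1 <= u]].
have infA : has_inf A.
  split; first by exists (f 1), 1 => //=.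
  by exists 0 => _ [u /= u1 <-]; apply: f0; exact: lt_le_trans u1.
have [_ [T /= T1 <-] fT] := inf_adherent eh0 infA.
exists T; split; first exact: num_real.
move=> t /ltW Tt; have t1 : 1 <= t by exact: le_trans Tt.
have t0 : 0 < t by exact: lt_le_trans t1.
apply: le_trans (derive_bound fD dfD t0 h0 _) _.
  by move=> u tu; apply: ddfC; exact: le_trans tu.
rewrite (splitr e); apply: lerD.
  rewrite ler_pdivrMr// distrC ger0_norm; last first.
    by rewrite subr_ge0; apply: anti => //; rewrite lerDl ltW.
  have inft : inf A <= f (t + h).
    apply: (ge_inf infA.2); exists (t + h) => //=.
    by rewrite (le_trans t1)// lerDl ltW.
  have := anti T t (lt_le_trans ltr01 T1) Tt.
  by move: fT inft; lra.
rewrite /h mulrCA -[leRHS]mulr1 ler_wpM2l//; first by rewrite divr_ge0// ltW.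
by rewrite ler_pdivrMr ?ltr_wpDl// mul1r lerDl.
Qed.

(** Over a long window a bounded [f] has a small difference quotient, and a small enough second
    derivative cannot move [df] far from it. *)
Lemma landau f df ddf B :
  (forall u, 0 < u -> is_derive u 1 f (df u)) ->
  (forall u, 0 < u -> is_derive u 1 df (ddf u)) ->
  (forall u, 1 <= u -> `|f u| <= B) ->
  ddf t @[t --> +oo] --> 0 ->
  df t @[t --> +oo] --> 0.
Proof.
move=> fD dfD fB /cvgr0Pnorm_le ddf0; apply/cvgr0Pnorm_le => e e0.
have B0 : 0 <= B by apply: le_trans (fB 1 _).
(* The increment of [f] is at most [2 * B], so this [h] brings the quotient below [e / 2]; the
   threshold [e / 2 / h] for [ddf] leaves [e / 2] for the other term. *)
set h := 4 * (B + 1) / e.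
have B1 : 0 < B + 1 by rewrite ltr_wpDl.
have h0 : 0 < h by rewrite divr_gt0// mulr_gt0.
have [|T [_ ddfT]] := ddf0 (e / 2 / h).
  by apply: divr_gt0 => //; exact: divr_gt0.
exists (Num.max 1 T); split; first exact: num_real.
move=> t; rewrite gt_max => /andP[/ltW t1 Tt].
have t0 : 0 < t by exact: lt_le_trans t1.
apply: le_trans (derive_bound fD dfD t0 h0 _) _.
  by move=> u tu; apply: ddfT; exact: lt_le_trans tu.
rewrite [leRHS](splitr e); apply: lerD; last by rewrite divfK// gt_eqF.
rewrite ler_pdivrMr//.
have -> : e / 2 * h = 2 * (B + 1) by rewrite /h; field; rewrite gt_eqF.
apply: le_trans (ler_normB _ _) _.
have := fB _ t1; have /fB : 1 <= t + h by rewrite (le_trans t1)// lerDl ltW.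
lra.
Qed.

End RealFunctions.

(** * Closure of entrywise membership in a function subspace under matrix operations *)

Section EntrywiseSubspaces.
Set Implicit Arguments.
Unset Strict Implicit.
Context {R : realType} {T : Type}.

(** Abstracting the subspace lets the same closure lemmas serve both linear functionals of the state
    and functions tending to 0 along a filter. *)
Definition fun_subspace (S : (T -> R) -> Prop) :=
  [/\ S (fun=> 0), (forall f g, S f -> S g -> S (fun x => f x + g x))
    & (forall c f, S f -> S (fun x => c * f x))].

Definition entries_in (S : (T -> R) -> Prop) p q (M : T -> 'M[R]_(p, q)) :=
  forall a b, S (fun x => M x a b).

Variable S : (T -> R) -> Prop.
Hypothesis subS : fun_subspace S.

Lemma subspace_sum (I : Type) (r : seq I) (f : I -> T -> R) :
  (forall i, S (f i)) -> S (fun x => \sum_(i <- r) f i x).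
Proof.
have [S0 SD _] := subS => Sf; elim: r => [|i r IHr].
  by rewrite (_ : (fun _ => _) = fun=> 0)//; apply/funext => x; rewrite big_nil.
rewrite (_ : (fun _ => _) = fun x => f i x + \sum_(j <- r) f j x); first exact: SD.
by apply/funext => x; rewrite big_cons.
Qed.

Lemma entriesD p q (M N : T -> 'M[R]_(p, q)) :
  entries_in S M -> entries_in S N -> entries_in S (fun x => M x + N x).
Proof.
have [_ SD _] := subS => SM SN a b.
rewrite (_ : (fun _ => _) = fun x => M x a b + N x a b); first exact: SD.
by apply/funext => x; rewrite mxE.
Qed.

Lemma entriesZ p q c (M : T -> 'M[R]_(p, q)) :
  entries_in S M -> entries_in S (fun x => c *: M x).
Proof.
have [_ _ SZ] := subS => SM a b.
rewrite (_ : (fun _ => _) = fun x => c * M x a b); first exact: SZ.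
by apply/funext => x; rewrite mxE.
Qed.

Lemma entriesN p q (M : T -> 'M[R]_(p, q)) :
  entries_in S M -> entries_in S (fun x => - M x).
Proof.
move=> SM; rewrite (_ : (fun _ => _) = fun x => -1 *: M x); first exact: entriesZ.
by apply/funext => x; rewrite scaleN1r.
Qed.

Lemma entriesB p q (M N : T -> 'M[R]_(p, q)) :
  entries_in S M -> entries_in S N -> entries_in S (fun x => M x - N x).
Proof. by move=> SM SN; apply: entriesD => //; exact: entriesN. Qed.

Lemma entries_sum p q (I : finType) (M : I -> T -> 'M[R]_(p, q)) :
  (forall i, entries_in S (M i)) -> entries_in S (fun x => \sum_i M i x).
Proof.
move=> SM a b.
rewrite (_ : (fun _ => _) = fun x => \sum_i M i x a b).
  by apply: subspace_sum => i; exact: SM.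
by apply/funext => x; rewrite summxE.
Qed.

Lemma entriesT p q (M : T -> 'M[R]_(p, q)) :
  entries_in S M -> entries_in S (fun x => (M x)^T).
Proof.
move=> SM a b; rewrite (_ : (fun _ => _) = fun x => M x b a); first exact: SM.
by apply/funext => x; rewrite mxE.
Qed.

Lemma entries_mulr p q r (C : 'M[R]_(q, r)) (M : T -> 'M[R]_(p, q)) :
  entries_in S M -> entries_in S (fun x => M x *m C).
Proof.
have [_ _ SZ] := subS => SM a b.
rewrite (_ : (fun _ => _) = fun x => \sum_k C k b * M x a k).
  by apply: subspace_sum => k; exact: SZ.
by apply/funext => x; rewrite mxE; apply: eq_bigr => k _; rewrite mulrC.
Qed.

Lemma entries_mull p q r (C : 'M[R]_(p, q)) (M : T -> 'M[R]_(q, r)) :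
  entries_in S M -> entries_in S (fun x => C *m M x).
Proof.
move=> SM; rewrite (_ : (fun _ => _) = fun x => ((M x)^T *m C^T)^T).
  by apply/entriesT/entries_mulr/entriesT.
by apply/funext => x; rewrite trmx_mul !trmxK.
Qed.

Lemma entries_col p q i (M : T -> 'M[R]_(p, q)) :
  entries_in S M -> entries_in S (fun x => col i (M x)).
Proof.
move=> SM a b; rewrite (_ : (fun _ => _) = fun x => M x a i); first exact: SM.
by apply/funext => x; rewrite mxE.
Qed.

Lemma entries_row p q i (M : T -> 'M[R]_(p, q)) :
  entries_in S M -> entries_in S (fun x => row i (M x)).
Proof.
move=> SM a b; rewrite (_ : (fun _ => _) = fun x => M x i b); first exact: SM.
by apply/funext => x; rewrite mxE.
Qed.

Lemma entries_only_col n i (u : T -> 'cV[R]_n) :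
  entries_in S u -> entries_in S (fun x => only_col i (u x)).
Proof.
have [S0 _ _] := subS => Su a b.
rewrite (_ : (fun _ => _) = fun x => if b == i then u x a 0 else 0).
  by case: (b == i); [exact: Su|].
by apply/funext => x; rewrite mxE.
Qed.

Lemma entries_only_row n i (u : T -> 'cV[R]_n) :
  entries_in S u -> entries_in S (fun x => only_row i (u x)).
Proof.
have [S0 _ _] := subS => Su a b.
rewrite (_ : (fun _ => _) = fun x => if a == i then u x b 0 else 0).
  by case: (a == i); [exact: Su|].
by apply/funext => x; rewrite mxE.
Qed.

(** The hypothesis concerns weighted differences instead of [X] itself, because along a solution the
    differences across edges tend to 0 while the matrices need not. *)
Lemma entries_disagreement n (w : 'I_n -> 'I_n -> R)
    (X : T -> 'I_n -> 'M[R]_n) i :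
  (forall j, entries_in S (fun x => w i j *: (X x i - X x j))) ->
  entries_in S (fun x => disagreement w (X x) i).
Proof. by move=> SX; exact: (entries_sum (M := fun j x => w i j *: (X x i - X x j))). Qed.

(** Stated through residuals and disagreements, so that it yields both the linearity of the field
    and the decay of the second derivative of P. *)
Lemma entries_sysP n (w : 'I_n -> 'I_n -> R) (A B : 'M[R]_n)
    (X : T -> state R n) i :
  entries_in S (fun x => res_y A (X x) i) ->
  entries_in S (fun x => slambda (X x) i) ->
  entries_in S (fun x => disagreement w (sTheta (X x)) i) ->
  entries_in S (fun x => disagreement w (sP (X x)) i) ->
  entries_in S (fun x => res_z B (X x) i) ->
  entries_in S (fun x => sP (system_D w A B (X x)) i).
Proof.
move=> Sry Sl SdT SdP Srz; apply: entries_mulr.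
apply: entriesB; last exact: entries_mull.
apply: entriesB; last exact: SdP.
apply: entriesB; last exact: SdT.
apply: entriesB; first by apply/entriesN/entries_mulr.
by apply/entries_mull/entriesT.
Qed.

End EntrywiseSubspaces.

(** * States as finite families of real coordinates, and linearity of the field *)

Section Coordinates.
Set Implicit Arguments.
Unset Strict Implicit.
Context {R : realType} {n : nat}.
Implicit Types (X Y : state R n).

Definition coordinate : finType :=
  (('I_n * 'I_n * 'I_n + 'I_n * 'I_n * 'I_n) +
   ('I_n * 'I_n * 'I_n + 'I_n * 'I_n * 'I_n) +
   ('I_n * 'I_n + 'I_n * 'I_n + 'I_n * 'I_n))%type.

Definition entry X (c : coordinate) : R :=
  match c with
  | inl (inl (inl (i, a, b))) => sP X i a b
  | inl (inl (inr (i, a, b))) => sK X i a b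
  | inl (inr (inl (i, a, b))) => sTheta X i a b
  | inl (inr (inr (i, a, b))) => sUpsilon X i a b
  | inr (inl (inl (i, a))) => sy X i a 0
  | inr (inl (inr (i, a))) => sz X i a 0
  | inr (inr (i, a)) => slambda X i a 0
  end.

Definition of_entries (x : coordinate -> R) : state R n := {|
  sP := fun i => \matrix_(a, b) x (inl (inl (inl (i, a, b))));
  sK := fun i => \matrix_(a, b) x (inl (inl (inr (i, a, b))));
  sTheta := fun i => \matrix_(a, b) x (inl (inr (inl (i, a, b))));
  sUpsilon := fun i => \matrix_(a, b) x (inl (inr (inr (i, a, b))));
  sy := fun i => \col_a x (inr (inl (inl (i, a))));
  sz := fun i => \col_a x (inr (inl (inr (i, a))));
  slambda := fun i => \col_a x (inr (inr (i, a)))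
|}.

Lemma of_entriesK x c : entry (of_entries x) c = x c.
Proof.
by case: c => [[[[[i a] b]|[[i a] b]]|[[[i a] b]|[[i a] b]]]|[[[i a]|[i a]]|[i a]]];
  rewrite /= mxE.
Qed.

Definition state_sub X Y := of_entries (fun c => entry X c - entry Y c).

Lemma entry_sub X Y c : entry (state_sub X Y) c = entry X c - entry Y c.
Proof. exact: of_entriesK. Qed.

(** Since [Pr] ranges over properties of functionals, this and its converse [all_entry] transfer
    linearity, limits, derivatives and zeros alike between coordinates and matrix blocks. *)
Lemma entry_all (Pr : (state R n -> R) -> Prop) :
  (forall c, Pr (entry^~ c)) ->
  forall i, (forall a b, Pr (fun X => sP X i a b)) /\
    (forall a b, Pr (fun X => sK X i a b)) /\
    (forall a b, Pr (fun X => sTheta X i a b)) /\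
    (forall a b, Pr (fun X => sUpsilon X i a b)) /\
    (forall a b, Pr (fun X => sy X i a b)) /\
    (forall a b, Pr (fun X => sz X i a b)) /\
    (forall a b, Pr (fun X => slambda X i a b)).
Proof.
move=> Prc i; split; [|split; [|split; [|split; [|split; [|split]]]]] => a b.
- exact: (Prc (inl (inl (inl (i, a, b))))).
- exact: (Prc (inl (inl (inr (i, a, b))))).
- exact: (Prc (inl (inr (inl (i, a, b))))).
- exact: (Prc (inl (inr (inr (i, a, b))))).
- rewrite ord1; exact: (Prc (inr (inl (inl (i, a))))).
- rewrite ord1; exact: (Prc (inr (inl (inr (i, a))))).
- rewrite ord1; exact: (Prc (inr (inr (i, a)))).
Qed.

Lemma all_entry (Pr : (state R n -> R) -> Prop) :
  (forall i, (forall a b, Pr (fun X => sP X i a b)) /\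
    (forall a b, Pr (fun X => sK X i a b)) /\
    (forall a b, Pr (fun X => sTheta X i a b)) /\
    (forall a b, Pr (fun X => sUpsilon X i a b)) /\
    (forall a b, Pr (fun X => sy X i a b)) /\
    (forall a b, Pr (fun X => sz X i a b)) /\
    (forall a b, Pr (fun X => slambda X i a b))) ->
  forall c, Pr (entry^~ c).
Proof.
move=> Pra [[[[[i a] b]|[[i a] b]]|[[[i a] b]|[[i a] b]]]|[[[i a]|[i a]]|[i a]]];
  have [H1 [H2 [H3 [H4 [H5 [H6 H7]]]]]] := Pra i.
- exact: H1.
- exact: H2.
- exact: H3.
- exact: H4.
- exact: H5.
- exact: H6.
- exact: H7.
Qed.

(** The record [state] is handled through its coordinates, so linearity is the existence of a
    coefficient vector. *)
Definition linear_functional (l : state R n -> R) :=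
  exists g : coordinate -> R, forall X, l X = \sum_c g c * entry X c.

Lemma linear_subspace : fun_subspace linear_functional.
Proof.
split=> [|f g [u fE] [v gE]|k f [u fE]].
- by exists (fun=> 0) => X; rewrite big1// => c _; rewrite mul0r.
- exists (fun c => u c + v c) => X; rewrite fE gE -big_split/=.
  by apply: eq_bigr => c _; rewrite mulrDl.
- exists (fun c => k * u c) => X; rewrite fE mulr_sumr.
  by apply: eq_bigr => c _; rewrite mulrA.
Qed.

Lemma linear_entry c : linear_functional (entry^~ c).
Proof.
exists (fun d => (d == c)%:R) => X; rewrite (bigD1 c)//= eqxx mul1r.
by rewrite big1 ?addr0// => d /negPf ->; rewrite mul0r.
Qed.

Section System.
Variables (w : 'I_n -> 'I_n -> R) (A B : 'M[R]_n).
Local Notation F := (system_D w A B).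

Lemma linear_parts i :
  (entries_in linear_functional (fun X => res_y A X i)) /\
  (entries_in linear_functional (fun X => res_z B X i)).
Proof.
have [lP [lK [lT [lU [ly [lz ll]]]]]] := entry_all linear_entry i.
have sub := linear_subspace; split; apply: entriesB => //.
- exact: entries_mulr.
- exact: entries_mull.
- exact: entriesT.
Qed.

Lemma linear_diff (f : state R n -> 'I_n -> 'M[R]_n) i :
  (forall j, entries_in linear_functional (fun X => f X j)) ->
  entries_in linear_functional (fun X => disagreement w (f X) i).
Proof.
move=> lf; have sub := linear_subspace; apply: entries_disagreement => // j.
by apply: entriesZ => //; apply: entriesB.
Qed.

Lemma linear_system c : linear_functional (fun X => entry (F X) c).
Proof.
have sub := linear_subspace.
have lin := entry_all linear_entry.
pose Pr (l : state R n -> R) := linear_functional (fun X => l (F X)).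
apply: (all_entry (Pr := Pr)) => i.
have [lry lrz] := linear_parts i.
have [lP [lK [lT [lU [ly [lz ll]]]]]] := lin i.
have dP := linear_diff i (fun j => (lin j).1).
have dK := linear_diff i (fun j => (lin j).2.1).
have dT := linear_diff i (fun j => (lin j).2.2.1).
have dU := linear_diff i (fun j => (lin j).2.2.2.1).
split; [|split; [|split; [|split; [|split; [|split]]]]] => //.
- by apply: (@entries_sysP _ _ _ sub _ w A B id).
- apply: entriesB => //; apply: entriesB => //; apply: entriesB => //.
    exact: entries_only_col.
  exact: entries_only_row.
- by apply: entriesB => //; exact: entries_col.
- apply: entriesT => //; apply: entriesD => //; apply: entriesD => //.
    exact: entriesT.
  exact: entries_row.
- exact: entriesT.
Qed.

End System.
End Coordinates.

(** * The Frobenius inner product and the graph Laplacian form *)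

Section MatrixInnerProduct.
Set Implicit Arguments.
Unset Strict Implicit.
Context {R : realType}.

Definition mxdot p q (M N : 'M[R]_(p, q)) := \tr (M^T *m N).

Lemma mxdotE p q (M N : 'M[R]_(p, q)) :
  mxdot M N = \sum_a \sum_b M a b * N a b.
Proof.
rewrite exchange_big; apply: eq_bigr => b _; rewrite mxE.
by apply: eq_bigr => a _; rewrite mxE.
Qed.

Lemma mxdotC p q (M N : 'M[R]_(p, q)) : mxdot M N = mxdot N M.
Proof. by rewrite /mxdot -mxtrace_tr trmx_mul trmxK. Qed.

Lemma mxdotDr p q (M N N' : 'M[R]_(p, q)) :
  mxdot M (N + N') = mxdot M N + mxdot M N'.
Proof. by rewrite /mxdot mulmxDr raddfD. Qed.

Lemma mxdotNr p q (M N : 'M[R]_(p, q)) : mxdot M (- N) = - mxdot M N.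
Proof. by rewrite /mxdot mulmxN raddfN. Qed.

Lemma mxdotZr p q c (M N : 'M[R]_(p, q)) : mxdot M (c *: N) = c * mxdot M N.
Proof. by rewrite /mxdot -scalemxAr mxtraceZ. Qed.

Lemma mxdotDl p q (M N N' : 'M[R]_(p, q)) :
  mxdot (N + N') M = mxdot N M + mxdot N' M.
Proof. by rewrite mxdotC mxdotDr !(mxdotC M). Qed.

Lemma mxdotNl p q (M N : 'M[R]_(p, q)) : mxdot (- N) M = - mxdot N M.
Proof. by rewrite mxdotC mxdotNr mxdotC. Qed.

Lemma mxdot_sumr p q (I : finType) (M : 'M[R]_(p, q)) (N : I -> 'M[R]_(p, q)) :
  mxdot M (\sum_i N i) = \sum_i mxdot M (N i).
Proof. by rewrite /mxdot mulmx_sumr raddf_sum. Qed.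

Lemma mxdot_tr p q (M N : 'M[R]_(p, q)) : mxdot M^T N^T = mxdot M N.
Proof. by rewrite [RHS]mxdotC /mxdot trmxK mxtrace_mulC. Qed.

Lemma mxdot_mull p q r (M : 'M[R]_(p, r)) (C : 'M[R]_(p, q)) N :
  mxdot M (C *m N) = mxdot (C^T *m M) N.
Proof. by rewrite /mxdot trmx_mul trmxK mulmxA. Qed.

Lemma mxdot_mulr p q r (M : 'M[R]_(p, r)) (C : 'M[R]_(q, r)) N :
  mxdot M (N *m C) = mxdot (M *m C^T) N.
Proof. by rewrite -mxdot_tr trmx_mul mxdot_mull -mxdot_tr trmx_mul !trmxK. Qed.

Lemma mxdot_ge0 p q (M : 'M[R]_(p, q)) : 0 <= mxdot M M.
Proof.
by rewrite mxdotE; apply: sumr_ge0 => a _; apply: sumr_ge0 => b _; rewrite -expr2 sqr_ge0.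
Qed.

Lemma sqr_le_mxdot p q (M : 'M[R]_(p, q)) a b : M a b ^+ 2 <= mxdot M M.
Proof.
have ge0 i j : 0 <= M i j * M i j by rewrite -expr2 sqr_ge0.
rewrite mxdotE (bigD1 a)//= (bigD1 b)//= -expr2 -addrA lerDl addr_ge0//.
  exact: sumr_ge0.
by apply: sumr_ge0 => i _; exact: sumr_ge0.
Qed.

Lemma mxdot_only_col n (M : 'M[R]_n) i (u : 'cV[R]_n) :
  mxdot M (only_col i u) = mxdot (col i M) u.
Proof.
rewrite !mxdotE; apply: eq_bigr => a _; rewrite big_ord1 (bigD1 i)//= !mxE eqxx.
by rewrite big1 ?addr0// => j /negPf ji; rewrite mxE ji mulr0.
Qed.

Lemma mxdot_only_row n (M : 'M[R]_n) i (u : 'cV[R]_n) :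
  mxdot M (only_row i u) = mxdot (row i M) u^T.
Proof.
rewrite !mxdotE big_ord1 (bigD1 i)//= [X in _ + X]big1 ?addr0.
  by apply: eq_bigr => b _; rewrite !mxE eqxx.
by move=> j /negPf ji; apply: big1 => b _; rewrite mxE ji mulr0.
Qed.

(** The projector in [projD] is symmetric, so it can be moved onto [M], which it fixes. *)
Lemma mxdot_projD n (M V : 'M[R]_n) : M *m ones = 0 ->
  mxdot M (projD V) = mxdot M V.
Proof.
move=> M1; rewrite /projD mxdot_mulr; congr mxdot.
rewrite [in LHS]raddfB/= trmx1 linearZ/= trmx_mul trmxK mulmxBr mulmx1.
by rewrite -scalemxAr mulmxA M1 mul0mx scaler0 subr0.
Qed.

Section Disagreement.
Variables (n : nat) (w : 'I_n -> 'I_n -> R).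
Hypothesis wC : forall i j, w i j = w j i.

(** Exchange the two agents in the double sum and average. The result is symmetric in [X] and [Y],
    and nonnegative for [X = Y] when the weights are. *)
Lemma mxdot_disagreement (X Y : 'I_n -> 'M[R]_n) :
  \sum_i mxdot (X i) (disagreement w Y i) =
  2^-1 * \sum_i \sum_j w i j * mxdot (X i - X j) (Y i - Y j).
Proof.
have E : \sum_i mxdot (X i) (disagreement w Y i) =
    \sum_i \sum_j w i j * mxdot (X i) (Y i - Y j).
  by apply: eq_bigr => i _; rewrite mxdot_sumr; apply: eq_bigr => j _; rewrite mxdotZr.
have E' : \sum_i mxdot (X i) (disagreement w Y i) =
    \sum_i \sum_j w i j * mxdot (- X j) (Y i - Y j).
  rewrite E exchange_big; apply: eq_bigr => i _; apply: eq_bigr => j _.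
  by rewrite wC mxdotNl -mxdotNr opprB.
have -> : \sum_i \sum_j w i j * mxdot (X i - X j) (Y i - Y j) =
    \sum_i mxdot (X i) (disagreement w Y i) + \sum_i mxdot (X i) (disagreement w Y i).
  rewrite {1}E E' -big_split/=; apply: eq_bigr => i _.
  by rewrite -big_split/=; apply: eq_bigr => j _; rewrite -mulrDr -mxdotDl.
by rewrite -mulr2n -[X in _ * X]mulr_natl mulrA mulVf ?mul1r// pnatr_eq0.
Qed.

End Disagreement.
End MatrixInnerProduct.

Lemma projD_ones {R : realType} {n : nat} (V : 'M[R]_n) : projD V *m ones = 0.
Proof.
(* For [n = 0] the factor [n%:R^-1] is not a true inverse, but an empty matrix is trivially 0. *)
case: n V => [V|n V]; first by rewrite [LHS]flatmx0.
rewrite /projD -mulmxA mulmxBl mul1mx -scalemxAl -mulmxA.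
rewrite (_ : ones^T *m ones = n.+1%:R%:M).
  by rewrite mul_mx_scalar scalerA mulVf ?pnatr_eq0// scale1r subrr mulmx0.
apply/matrixP => i j; rewrite !ord1 !mxE eqxx mulr1n.
under eq_bigr do rewrite !mxE mulr1.
by rewrite sumr_const card_ord.
Qed.

(** * The squared norm of a state and its dissipation along the field *)

Section Energy.
Set Implicit Arguments.
Unset Strict Implicit.
Context {R : realType} {n : nat}.
Implicit Types (X Y : state R n).

Definition state_dot X Y := \sum_c entry X c * entry Y c.

Lemma state_dotE X Y : state_dot X Y =
  \sum_i (mxdot (sP X i) (sP Y i) + mxdot (sK X i) (sK Y i) +
    mxdot (sTheta X i) (sTheta Y i) + mxdot (sUpsilon X i) (sUpsilon Y i) +
    mxdot (sy X i) (sy Y i) + mxdot (sz X i) (sz Y i) +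
    mxdot (slambda X i) (slambda Y i)).
Proof.
have mxE' (f g : 'I_n -> 'M[R]_n) : \sum_(c : 'I_n * 'I_n * 'I_n)
    f c.1.1 c.1.2 c.2 * g c.1.1 c.1.2 c.2 = \sum_i mxdot (f i) (g i).
  under [RHS]eq_bigr do rewrite mxdotE.
  by rewrite pair_bigA/= pair_bigA/=.
have cvE (f g : 'I_n -> 'cV[R]_n) : \sum_(c : 'I_n * 'I_n)
    f c.1 c.2 0 * g c.1 c.2 0 = \sum_i mxdot (f i) (g i).
  under [RHS]eq_bigr do rewrite mxdotE.
  by rewrite pair_bigA/=; apply: eq_bigr => c _; rewrite big_ord1.
rewrite !big_split/= -!mxE' -!cvE /state_dot !big_sumType/= !addrA.
by do !congr (_ + _); apply: eq_bigr => -[] // [].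
Qed.

Lemma state_dotC X Y : state_dot X Y = state_dot Y X.
Proof. by apply: eq_bigr => c _; rewrite mulrC. Qed.

Lemma state_dot_ge0 X : 0 <= state_dot X X.
Proof. by apply: sumr_ge0 => c _; rewrite -expr2 sqr_ge0. Qed.

Lemma sqr_entry_le X c : entry X c ^+ 2 <= state_dot X X.
Proof.
rewrite /state_dot (bigD1 c)//= -expr2 lerDl.
by apply: sumr_ge0 => d _; rewrite -expr2 sqr_ge0.
Qed.

Lemma state_dot_bound X Y :
  `|state_dot X Y| *+ 2 <= state_dot X X + state_dot Y Y.
Proof.
rewrite -normrMn ler_norml; apply/andP; split.
  rewrite -subr_ge0 opprK.
  have -> : state_dot X Y *+ 2 + (state_dot X X + state_dot Y Y) =
      \sum_c (entry X c + entry Y c) ^+ 2.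
    rewrite /state_dot -sumrMnl -!big_split/=; apply: eq_bigr => c _; ring.
  by apply: sumr_ge0 => c _; exact: sqr_ge0.
rewrite -subr_ge0.
have -> : state_dot X X + state_dot Y Y - state_dot X Y *+ 2 =
    \sum_c (entry X c - entry Y c) ^+ 2.
  rewrite /state_dot -sumrMnl -sumrN -!big_split/=; apply: eq_bigr => c _; ring.
by apply: sumr_ge0 => c _; exact: sqr_ge0.
Qed.

Section Dissipation.
Variables (w : 'I_n -> 'I_n -> R) (A B : 'M[R]_n).
Hypothesis wC : forall i j, w i j = w j i.
Hypothesis w0 : forall i j, 0 <= w i j.
Local Notation F := (system_D w A B).

(** The direction space of the affine constraint [Dn]: it contains the values of the field and the
    differences of constrained states. *)
Definition tangent X := forall i, sP X i *m ones = 0.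

Lemma tangent_system X : tangent (F X).
Proof. by move=> i; exact: projD_ones. Qed.

Definition dissipation X :=
  \sum_i mxdot (res_y A X i) (res_y A X i) +
  \sum_i mxdot (res_z B X i) (res_z B X i) +
  \sum_i mxdot (sP X i) (disagreement w (sP X) i) +
  \sum_i mxdot (sUpsilon X i) (disagreement w (sUpsilon X) i).

(* The system is a saddle flow: the terms of [<X, F X>] that couple the primal
   variables P, y, z, K with the multipliers lambda, Theta, Upsilon cancel. *)
Lemma energy_identity X : tangent X -> state_dot X (F X) = - dissipation X.
Proof.
move=> tX; rewrite state_dotE /dissipation.
(* These couplings cancel only after summation over the agents, by symmetry of the Laplacian form;
   those through lambda, y and z cancel agent by agent. *)
pose cross i := mxdot (sTheta X i) (disagreement w (sP X) i)
  - mxdot (sP X i) (disagreement w (sTheta X) i)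
  + (mxdot (sK X i) (disagreement w (sUpsilon X) i)
  - mxdot (sUpsilon X i) (disagreement w (sK X) i)).
have cross0 : \sum_i cross i = 0.
  rewrite !(big_split, sumrN)/= !mxdot_disagreement//.
  have E (f g : 'I_n -> 'M[R]_n) :
      \sum_i \sum_j w i j * mxdot (f i - f j) (g i - g j) =
      \sum_i \sum_j w i j * mxdot (g i - g j) (f i - f j).
    by apply: eq_bigr => i _; apply: eq_bigr => j _; rewrite mxdotC.
  by rewrite (E (sTheta X)) (E (sK X)) !subrr addr0.
rewrite -[LHS]subr0 -[X in _ - X = _]cross0 -sumrB -!big_split/= -sumrN.
apply: eq_bigr => i _; rewrite /cross.
rewrite mxdot_projD// !(mxdotDr, mxdotNr).
rewrite mxdot_only_col mxdot_only_row mxdot_mulr trmxK !(mxdot_mull (sP X i)).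
rewrite -[mxdot (slambda X i) _]mxdot_tr trmxK -[mxdot (sz X i) _]mxdot_tr trmxK.
rewrite /res_y /res_z; set Pa := _ *m col i A; set bP := _ *m sP X i.
rewrite !(mxdotDr, mxdotDl, mxdotNr, mxdotNl).
rewrite (mxdotC (sz X i)^T bP) (mxdotC (sy X i) Pa) (mxdotC (sz X i)^T (row _ _)).
rewrite (mxdotC (sz X i)^T (slambda X i)^T) (mxdotC (slambda X i)^T bP).
rewrite (mxdotC (sy X i) (col _ _)).
ring.
Qed.

Lemma disagreement_form_ge0 (Y : 'I_n -> 'M[R]_n) :
  0 <= \sum_i mxdot (Y i) (disagreement w Y i).
Proof.
rewrite mxdot_disagreement// mulr_ge0 ?invr_ge0//.
apply: sumr_ge0 => i _; apply: sumr_ge0 => j _.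
by rewrite mulr_ge0 ?mxdot_ge0.
Qed.

Lemma edge_le_disagreement_form (Y : 'I_n -> 'M[R]_n) i j :
  w i j * mxdot (Y i - Y j) (Y i - Y j) <=
  2 * \sum_k mxdot (Y k) (disagreement w Y k).
Proof.
rewrite mxdot_disagreement// mulrA mulfV ?pnatr_eq0// mul1r.
have ge0 k l : 0 <= w k l * mxdot (Y k - Y l) (Y k - Y l).
  by rewrite mulr_ge0 ?mxdot_ge0.
rewrite (bigD1 i)//= (bigD1 j)//= -addrA lerDl addr_ge0//.
  exact: sumr_ge0.
by apply: sumr_ge0 => k _; exact: sumr_ge0.
Qed.

Lemma dissipation_bounds X i j a b :
  [/\ 0 <= dissipation X,
      res_y A X i a 0 ^+ 2 <= dissipation X,
      res_z B X i 0 b ^+ 2 <= dissipation X,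
      w i j * (sP X i - sP X j) a b ^+ 2 <= 2 * dissipation X
    & w i j * (sUpsilon X i - sUpsilon X j) a b ^+ 2 <= 2 * dissipation X].
Proof.
have P0 := disagreement_form_ge0 (sP X).
have U0 := disagreement_form_ge0 (sUpsilon X).
have Pij := edge_le_disagreement_form (sP X) i j.
have Uij := edge_le_disagreement_form (sUpsilon X) i j.
have y0 : 0 <= \sum_k mxdot (res_y A X k) (res_y A X k).
  by apply: sumr_ge0 => k _; exact: mxdot_ge0.
have z0 : 0 <= \sum_k mxdot (res_z B X k) (res_z B X k).
  by apply: sumr_ge0 => k _; exact: mxdot_ge0.
have yi : res_y A X i a 0 ^+ 2 <= \sum_k mxdot (res_y A X k) (res_y A X k).
  rewrite (bigD1 i)//=; apply: le_trans (sqr_le_mxdot _ a 0) _.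
  by rewrite lerDl; apply: sumr_ge0 => k _; exact: mxdot_ge0.
have zi : res_z B X i 0 b ^+ 2 <= \sum_k mxdot (res_z B X k) (res_z B X k).
  rewrite (bigD1 i)//=; apply: le_trans (sqr_le_mxdot _ 0 b) _.
  by rewrite lerDl; apply: sumr_ge0 => k _; exact: mxdot_ge0.
have Pab := ler_wpM2l (w0 i j) (sqr_le_mxdot (sP X i - sP X j) a b).
have Uab := ler_wpM2l (w0 i j) (sqr_le_mxdot (sUpsilon X i - sUpsilon X j) a b).
rewrite /dissipation; split; lra.
Qed.

End Dissipation.
End Energy.

(** * Functions tending to 0 *)

Section Vanishing.
Set Implicit Arguments.
Unset Strict Implicit.
Context {R : realType}.

Lemma cvg0_subspace (T : Type) (G : set_system T) {FG : Filter G} :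
  fun_subspace (fun f : T -> R => f t @[t --> G] --> 0).
Proof.
split=> [|f g f0 g0|c f f0]; first exact: cvg_cst.
  by rewrite -[X in _ --> X]addr0; exact: cvgD.
by rewrite -[X in _ --> X](mulr0 c); apply: cvgM => //; exact: cvg_cst.
Qed.

Definition vanishing (f : R -> R) := f t @[t --> +oo] --> 0.

Lemma vanishing_subspace : fun_subspace vanishing.
Proof. exact: cvg0_subspace. Qed.

Lemma vanishing_sqr_le (f g : R -> R) c : vanishing g -> 0 < c ->
  (forall t, 0 < t -> c * f t ^+ 2 <= g t) -> vanishing f.
Proof.
move=> /cvgr0Pnorm_le g0 c0 fg; apply/cvgr0Pnorm_le => e e0.
have [|T [_ gT]] := g0 (c * e ^+ 2); first by rewrite mulr_gt0// exprn_gt0.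
exists (Num.max 0 T); split; first exact: num_real.
move=> t; rewrite gt_max => /andP[t0 /gT/(le_trans (ler_norm _)) gt].
rewrite -(ler_pXn2r (n := 2))// ?nnegrE//; last exact: ltW.
rewrite real_normK ?num_real//.
by rewrite -(ler_pM2l c0) (le_trans (fg _ t0)).
Qed.

End Vanishing.

(** * Energy decay along solutions and vanishing of their velocity *)

Section Solutions.
Set Implicit Arguments.
Unset Strict Implicit.
Context {R : realType} {n : nat}.
Variables (w : 'I_n -> 'I_n -> R) (A B : 'M[R]_n).
Local Notation F := (system_D w A B).
Implicit Types (X Y : R -> state R n) (t s u : R).

(** Coordinatewise and with no condition at 0, so that it passes directly to [F (X t)] and to the
    difference from an equilibrium. *)
Definition solution X := forall t c, 0 < t ->
  is_derive t 1 (fun s => entry (X s) c) (entry (F (X t)) c).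

Lemma linear_is_derive l X t : linear_functional l -> solution X -> 0 < t ->
  is_derive t 1 (fun s => l (X s)) (l (F (X t))).
Proof.
move=> [g lE] solX t0; rewrite lE.
rewrite (_ : (fun _ => _) = fun s => \sum_c g c * entry (X s) c).
  by apply: is_derive_lincomb => c; exact: solX.
by apply/funext => s.
Qed.

Lemma linear_sub l (x y : state R n) : linear_functional l ->
  l (state_sub x y) = l x - l y.
Proof.
move=> [g lE]; rewrite !lE -sumrB; apply: eq_bigr => c _.
by rewrite entry_sub mulrBr.
Qed.

Lemma solution_system X : solution X -> solution (fun t => F (X t)).
Proof.
by move=> solX t c t0; exact: (linear_is_derive (linear_system w A B c)).
Qed.

Lemma solution_sub X (y : state R n) : solution X ->
  (forall c, entry (F y) c = 0) -> solution (fun t => state_sub (X t) y).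
Proof.
move=> solX Fy0 t c t0.
rewrite (linear_sub _ _ (linear_system w A B c)) Fy0.
rewrite (_ : (fun _ => _) = (fun s => entry (X s) c) - cst (entry y c)).
  by apply: is_deriveB; exact: solX.
by apply/funext => s; rewrite entry_sub.
Qed.

Lemma state_dot_is_derive X Y t : solution X -> solution Y -> 0 < t ->
  is_derive t 1 (fun s => state_dot (X s) (Y s))
    (state_dot (F (X t)) (Y t) + state_dot (X t) (F (Y t))).
Proof.
by move=> solX solY t0; apply: is_derive_dot => c; [exact: solX|exact: solY].
Qed.

Hypothesis wC : forall i j, w i j = w j i.
Hypothesis w0 : forall i j, 0 <= w i j.

Definition tangent_solution X :=
  solution X /\ forall t, 0 < t -> tangent (X t).

Lemma tangent_solution_system X : solution X ->
  tangent_solution (fun t => F (X t)).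
Proof.
by move=> solX; split=> [|t _]; [exact: solution_system|exact: tangent_system].
Qed.

Lemma dissipation_ge0 (x : state R n) : 0 <= dissipation w A B x.
Proof.
rewrite /dissipation !addr_ge0 ?disagreement_form_ge0//.
  by apply: sumr_ge0 => i _; exact: mxdot_ge0.
by apply: sumr_ge0 => i _; exact: mxdot_ge0.
Qed.

Lemma energy_is_derive X t : solution X -> 0 < t ->
  is_derive t 1 (fun s => state_dot (X s) (X s))
    (2 * state_dot (X t) (F (X t))).
Proof.
move=> solX t0; have := state_dot_is_derive solX solX t0.
by rewrite state_dotC -mulr2n mulr_natl.
Qed.

Lemma energy_slope_le0 X t : tangent_solution X -> 0 < t ->
  2 * state_dot (X t) (F (X t)) <= 0.
Proof.
move=> [_ tX] t0; rewrite energy_identity//; last exact: tX.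
by rewrite mulrN oppr_le0 mulr_ge0// dissipation_ge0.
Qed.

Lemma energy_anti X s t : tangent_solution X -> 0 < s -> s <= t ->
  state_dot (X t) (X t) <= state_dot (X s) (X s).
Proof.
move=> solX; apply: (derive_le0_anti (f := fun u => state_dot (X u) (X u))).
  by move=> u u0; exact: energy_is_derive solX.1 u0.
by move=> u u0; exact: energy_slope_le0.
Qed.

Lemma dissipation_vanishing X : tangent_solution X ->
  vanishing (fun t => dissipation w A B (X t)).
Proof.
move=> solX.
have solY := tangent_solution_system solX.1.
have solZ := tangent_solution_system solY.1.
pose df u := 2 * state_dot (X u) (F (X u)).
pose ddf u := 2 * (state_dot (F (X u)) (F (X u)) + state_dot (X u) (F (F (X u)))).
pose E (Y : R -> state R n) := state_dot (Y 1) (Y 1).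
suff df0 : vanishing df.
  have [_ _ /(_ (- 2^-1) _ df0)] := @vanishing_subspace R.
  apply: cvg_trans; apply: near_eq_cvg; exists 0; split; first exact: num_real.
  move=> t t0; rewrite /df energy_identity//; last exact: solX.2.
  by rewrite mulrA mulNr mulVf ?pnatr_eq0// mulN1r opprK.
(* The constant collects the energies of [X], [F X] and [F (F X)] at time 1, none of which increases
   afterwards; the mixed term uses [2 |<x, y>| <= |x|^2 + |y|^2]. *)
apply: (@barbalat R (fun u => state_dot (X u) (X u)) _ ddf
  (E X + E (fun t => F (F (X t))) + 2 * E (fun t => F (X t)))).
- by move=> u u0; exact: energy_is_derive solX.1 u0.
- by move=> u u0; apply: is_deriveZ; exact: state_dot_is_derive solX.1 solY.1 u0.
- by move=> u _; exact: state_dot_ge0.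
- by move=> u u0; exact: energy_slope_le0.
move=> u u1; rewrite /ddf mulrDr addrC.
apply: le_trans (ler_normD _ _) _; apply: lerD.
  rewrite normrM normr_nat mulr_natl; apply: le_trans (state_dot_bound _ _) _.
  by apply: lerD; [exact: energy_anti solX ltr01 u1|exact: energy_anti solZ ltr01 u1].
rewrite normrM normr_nat ger0_norm ?state_dot_ge0// ler_wpM2l//.
exact: energy_anti solY ltr01 u1.
Qed.

Lemma res_y_vanishing X i : tangent_solution X ->
  entries_in vanishing (fun t => res_y A (X t) i).
Proof.
move=> solX a b; rewrite ord1.
apply: (vanishing_sqr_le (dissipation_vanishing solX) ltr01) => t _.
by rewrite mul1r; have [] := dissipation_bounds A B wC w0 (X t) i i a a.
Qed.

Lemma res_z_vanishing X i : tangent_solution X ->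
  entries_in vanishing (fun t => res_z B (X t) i).
Proof.
move=> solX a b; rewrite ord1.
apply: (vanishing_sqr_le (dissipation_vanishing solX) ltr01) => t _.
by rewrite mul1r; have [] := dissipation_bounds A B wC w0 (X t) i i b b.
Qed.

Lemma edge_vanishing X i j : tangent_solution X -> 0 < w i j ->
  entries_in vanishing (fun t => sP (X t) i - sP (X t) j) /\
  entries_in vanishing (fun t => sUpsilon (X t) i - sUpsilon (X t) j).
Proof.
move=> solX wij; have w2 : 0 < w i j / 2 by exact: divr_gt0.
split=> a b; apply: (vanishing_sqr_le (dissipation_vanishing solX) w2) => t _;
  have [_ _ _ Pab Uab] := dissipation_bounds A B wC w0 (X t) i j a b; lra.
Qed.

Lemma disagreement_vanishing X i : tangent_solution X ->
  entries_in vanishing (fun t => disagreement w (sP (X t)) i) /\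
  entries_in vanishing (fun t => disagreement w (sUpsilon (X t)) i).
Proof.
move=> solX; have sub := @vanishing_subspace R.
split; apply: entries_disagreement => // j;
  (have [wij|wij|<-] := ltgtP 0 (w i j);
    [by apply: entriesZ => //; have [] := edge_vanishing solX wij
    |by have := w0 i j; rewrite leNgt wij
    |by move=> a b; under eq_fun do rewrite scale0r mxE; case: sub]).
Qed.

Variable H : rel 'I_n.
Hypothesis Hw : forall i j, H i j -> 0 < w i j.
Hypothesis Hconn : forall i j, connect H i j.

(** The differences across edges telescope along a path of [H] from [i] to [j]. *)
Lemma consensus_Upsilon X i j : tangent_solution X ->
  entries_in vanishing (fun t => sUpsilon (X t) i - sUpsilon (X t) j).
Proof.
move=> solX; have sub := @vanishing_subspace R.
have /connectP[p] := Hconn i j; elim: p i => [|k p IHp] i /=.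
  by move=> _ -> a b; under eq_fun do rewrite subrr mxE; case: sub.
move=> /andP[/Hw wik kp] jE; have [_ Uik] := edge_vanishing solX wik.
have := entriesD sub Uik (IHp k kp jE).
by under eq_fun do rewrite subrKA.
Qed.

(* A second derivative suffices for P: its own equation gives P'' -> 0, and P is
   bounded by the energy, hence P' -> 0. *)
Lemma system_vanishing X c : tangent_solution X ->
  vanishing (fun t => entry (F (X t)) c).
Proof.
move=> solX; have sub := @vanishing_subspace R.
have solY := tangent_solution_system solX.1.
have solW := tangent_solution_system solY.1.
(* The velocities of Theta, K and lambda are themselves disagreements or residuals of [X]. *)
have YT i : entries_in vanishing (fun t => sTheta (F (X t)) i).
  by have [] := disagreement_vanishing i solX.
have YK i : entries_in vanishing (fun t => sK (F (X t)) i).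
  by have [] := disagreement_vanishing i solX.
have Yl i : entries_in vanishing (fun t => slambda (F (X t)) i).
  by apply: entriesT => //; exact: res_z_vanishing.
(* Applied to [F X], the equation for P involves only residuals of [F X] and the velocities of Theta
   and lambda, all vanishing. *)
have WP i : entries_in vanishing (fun t => sP (F (F (X t))) i).
  have [dP _] := disagreement_vanishing i solY.
  apply: (entries_sysP sub) => //; first exact: res_y_vanishing.
    by apply: entries_disagreement => // j; apply: entriesZ => //; apply: entriesB.
  exact: res_z_vanishing.
have from_res Z i : tangent_solution Z ->
    entries_in vanishing (fun t => sP (Z t) i) ->
    entries_in vanishing (fun t => sy (Z t) i) /\
    entries_in vanishing (fun t => sz (Z t) i).
  move=> solZ ZP; split.
    have := entriesB sub (entries_mulr sub (col i A) ZP) (res_y_vanishing i solZ).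
    by under eq_fun do rewrite subKr.
  have := entriesB sub (entries_mull sub (col i B)^T ZP) (res_z_vanishing i solZ).
  by under eq_fun do rewrite subKr; move=> /entriesT; under eq_fun do rewrite trmxK.
(* The equation for y, applied to [F X], expresses column [i] of agent [i]'s Upsilon velocity as a
   residual minus the second derivative of y. *)
have YUcol i : entries_in vanishing (fun t => col i (sUpsilon (F (X t)) i)).
  have [Wy _] := from_res _ i solW (WP i).
  have := entriesB sub (res_y_vanishing i solY) Wy.
  by under eq_fun do rewrite subKr.
(* Only agent [b] controls column [b] directly; consensus carries this to every other agent. *)
have YU i : entries_in vanishing (fun t => sUpsilon (F (X t)) i).
  move=> a b; have E (M N : 'M[R]_n) : (M - N) a b + col b N a 0 = M a b.
    by rewrite !mxE subrK.
  have := YUcol b a 0; have := consensus_Upsilon i b solY a b.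
  case: (sub) => _ VD _ U1 U2; have := VD _ _ U1 U2.
  by under eq_fun do rewrite E.
have YP i : entries_in vanishing (fun t => sP (F (X t)) i).
  move=> a b; pose c' : coordinate := inl (inl (inl (i, a, b))).
  (* From [x ^+ 2 <= E] follows [|x| <= 1 + E], which avoids a square root. *)
  apply: (landau (f := fun t => entry (X t) c')
    (B := 1 + state_dot (X 1) (X 1)) _ _ _ (WP i a b)).
  - by move=> u; exact: (solX.1 u c').
  - by move=> u; exact: (solY.1 u c').
  - move=> u u1; have := energy_anti solX ltr01 u1.
    have := sqr_entry_le (X u) c'.
    move: (entry _ _) (state_dot _ _) (state_dot _ _) => x E E1.
    by move=> xE EE1; rewrite ler_norml; apply/andP; split; nra.
pose Pr (l : state R n -> R) := vanishing (fun t => l (F (X t))).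
apply: (all_entry (Pr := Pr)) => i; have [Yy Yz] := from_res _ i solY (YP i).
split; [exact: YP|split; [exact: YK|split; [exact: YT|split; [exact: YU|]]]].
by split; [exact: Yy|split; [exact: Yz|exact: Yl]].
Qed.

End Solutions.

(** * Kernel and range of the Laplacian of a connected graph *)

Section Laplacian.
Set Implicit Arguments.
Unset Strict Implicit.
Context {R : realType} {n : nat}.
Variables (w : 'I_n -> 'I_n -> R) (H : rel 'I_n).
Hypothesis wC : forall i j, w i j = w j i.
Hypothesis w0 : forall i j, 0 <= w i j.
Hypothesis Hw : forall i j, H i j -> 0 < w i j.
Hypothesis Hconn : forall i j, connect H i j.
Implicit Types (X : 'I_n -> 'M[R]_n).

Lemma sum_disagreement X : \sum_i disagreement w X i = 0.
Proof.
suff E : \sum_i disagreement w X i = - \sum_i disagreement w X i.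
  have /eqP : \sum_i disagreement w X i + \sum_i disagreement w X i = 0.
    by rewrite {2}E subrr.
  by rewrite -mulr2n -scaler_nat scaler_eq0 pnatr_eq0 => /eqP.
rewrite -sumrN [LHS]exchange_big; apply: eq_bigr => i _.
by rewrite -sumrN; apply: eq_bigr => j _; rewrite wC -scalerN opprB.
Qed.

(** The quadratic form of [X] is then 0, so [X] agrees across each edge, and connectedness spreads
    the agreement. *)
Lemma disagreement_eq0 X : (forall i, disagreement w X i = 0) ->
  forall i j, X i = X j.
Proof.
move=> X0 i j; have edge k l : H k l -> X k = X l.
  move=> /Hw wkl; apply/subr0_eq/matrixP => a b; rewrite [RHS]mxE.
  have := edge_le_disagreement_form wC w0 X k l.
  rewrite [X in _ <= _ * X]big1; last by move=> m _; rewrite X0 /mxdot mulmx0 mxtrace0.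
  rewrite mulr0 pmulr_rle0// => /(le_trans (sqr_le_mxdot _ a b)) le0.
  by apply/eqP; rewrite -sqrf_eq0 eq_le le0 sqr_ge0.
have /connectP[p] := Hconn i j; elim: p i => [|k p IHp] i /=; first by move=> _ ->.
by move=> /andP[/edge -> kp] /(IHp k kp).
Qed.

Let laplacian : 'M[R]_n :=
  \matrix_(i, j) ((i == j)%:R * \sum_k w i k - w i j).

Let mul_laplacian (k : 'I_n -> R) i :
  \sum_j k j * laplacian j i = \sum_j w i j * (k i - k j).
Proof.
under eq_bigr do rewrite mxE mulrBr.
rewrite sumrB (bigD1 i)//= eqxx mul1r [X in _ + X - _]big1 ?addr0; last first.
  by move=> j /negPf ->; rewrite mul0r mulr0.
rewrite mulr_sumr -sumrB; apply: eq_bigr => j _.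
by rewrite (wC j i) mulrBr ![_ * w _ _]mulrC.
Qed.

(** The Fredholm alternative: [g] is in the row space as soon as the cokernel annihilates it. By
    symmetry the cokernel columns lie in the kernel, hence are constant, and a zero-sum [g] is
    orthogonal to constants. *)
Lemma laplacian_solvable (g : 'I_n -> R) : \sum_i g i = 0 ->
  exists k : 'I_n -> R, forall i, \sum_j w i j * (k i - k j) = g i.
Proof.
move=> g0; pose v : 'rV[R]_n := \row_i g i.
suff /submxP[k vE] : (v <= laplacian)%MS.
  exists (k 0) => i; rewrite -mul_laplacian.
  by have /matrixP/(_ 0 i) := vE; rewrite !mxE => ->.
rewrite submxE; apply/eqP.
move: (cokermx laplacian) (mulmx_coker laplacian) => c lc.
apply/matrixP => a b; rewrite ord1 !mxE.
have cE i j : c i b = c j b.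
  (* Scalars become constant matrices so that the matrix-valued kernel lemma applies. *)
  pose X k : 'M[R]_n := const_mx (c k b).
  have X0 k : disagreement w X k = 0.
    apply/matrixP => p q; rewrite summxE mxE.
    under eq_bigr do rewrite !mxE.
    transitivity (\sum_j c j b * laplacian j k); first by rewrite mul_laplacian.
    have /matrixP/(_ k b) := lc.
    rewrite [in LHS]mxE [in RHS]mxE => lc0; rewrite -[RHS]lc0.
    by apply: eq_bigr => l _; rewrite mulrC !mxE eq_sym (wC l k); case: eqP => [->|_]; rewrite ?mul0r.
  by have /matrixP/(_ i i) := disagreement_eq0 X0 i j; rewrite !mxE.
under eq_bigr => j _ do rewrite !mxE (cE j b).
by rewrite -mulr_suml g0 mul0r.
Qed.

Lemma disagreement_solvable (G : 'I_n -> 'M[R]_n) : \sum_i G i = 0 ->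
  exists K : 'I_n -> 'M[R]_n, forall i, disagreement w K i = G i.
Proof.
move=> G0; have /choice[k kE] (ab : 'I_n * 'I_n) :
    exists k : 'I_n -> R, forall i, \sum_j w i j * (k i - k j) = G i ab.1 ab.2.
  apply: laplacian_solvable.
  by have /matrixP/(_ ab.1 ab.2) := G0; rewrite summxE mxE.
exists (fun i => \matrix_(a, b) k (a, b) i) => i; apply/matrixP => a b.
rewrite summxE -(kE (a, b)); apply: eq_bigr => j _; by rewrite !mxE.
Qed.

End Laplacian.

(** * Rigidity of friendly graphs and rounding to a permutation *)

Section Friendly.
Set Implicit Arguments.
Unset Strict Implicit.
Context {R : realType} {n : nat}.
Implicit Types (A B X P Pi : 'M[R]_n).

Lemma friendly_commutant A X : friendly A ->
  X *m A = A *m X -> X *m ones = ones -> X = 1%:M.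
Proof.
move=> [[e e_inj eA] vones] XA X1.
have ranks i : (0 < \rank (eigenspace A (e i)))%N by rewrite lt0n mxrank_eq0; exact: eA.
have direct : mxdirect (\sum_i eigenspace A (e i))%MS.
  by apply: mxdirect_sum_eigenspace => i j _ _; exact: e_inj.
have sumE : \rank (\sum_i eigenspace A (e i))%MS =
    (\sum_i \rank (eigenspace A (e i)))%N by exact/mxdirectP.
have ge1 (P : pred 'I_n) :
    (#|P| <= \sum_(i | P i) \rank (eigenspace A (e i)))%N.
  by rewrite -sum1_card; apply: leq_sum => i _.
(* The [n] eigenspaces are independent and nonzero in dimension [n], so each is a line, and together
   they span. *)
have rank1 i : \rank (eigenspace A (e i)) = 1%N.
  apply/eqP; rewrite eqn_leq ranks andbT.
  have := rank_leq_row (\sum_i eigenspace A (e i))%MS; rewrite sumE (bigD1 i)//=.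
  have := ge1 (predC1 i); rewrite cardC1 card_ord.
  move: (\sum_(_ | _) _)%N => m nm; have := ltn_ord i; lia.
have full : row_full (\sum_i eigenspace A (e i))%MS.
  by rewrite /row_full eqn_leq rank_leq_row sumE -[X in (X <= _)%N]card_ord ge1.
suff : (1%:M <= kermx (X - 1%:M))%MS.
  by move=> /sub_kermxP; rewrite mul1mx => /eqP; rewrite subr_eq0 => /eqP.
apply: submx_trans (submx_full _ full) _; apply/sumsmx_subP => i _.
have /eigenvalueP[v vA v0] := eA i.
have vE : (v <= eigenspace A (e i))%MS by exact/eigenspaceP.
have Ev : (eigenspace A (e i) <= v)%MS.
  by rewrite -(mxrank_leqif_sup vE) rank1 rank_rV v0.
apply: (submx_trans Ev); apply/sub_kermxP.
have : (v *m X <= eigenspace A (e i))%MS.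
  by apply/eigenspaceP; rewrite -mulmxA XA mulmxA vA scalemxAl.
move=> /submx_trans/(_ Ev)/sub_rVP[c vX].
have : v *m X *m ones = c *: (v *m ones) by rewrite vX scalemxAl.
rewrite -mulmxA X1 => /eqP; rewrite -subr_eq0 -{1}[v *m ones]scale1r -scalerBl.
rewrite scaler_eq0 (negPf (vones _ _ v0 vA)) orbF subr_eq0 => /eqP c1.
by rewrite mulmxBr mulmx1 vX -c1 scale1r subrr.
Qed.

Lemma perm_mx_unitary Pi : is_perm_mx Pi -> Pi^T *m Pi = 1%:M /\ Pi *m Pi^T = 1%:M.
Proof.
by move=> /is_perm_mxP[s ->]; rewrite tr_perm_mx -!perm_mxM mulVg mulgV perm_mx1.
Qed.

Lemma isomorphism_commute A B Pi : is_isomorphism A B Pi -> Pi *m A = B *m Pi.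
Proof.
move=> [/perm_mx_unitary[_ PiPiT] ->].
by rewrite -!mulmxA mulmxA PiPiT mul1mx.
Qed.

Lemma perm_mx_ones Pi : is_perm_mx Pi -> Pi *m ones = ones.
Proof.
move=> /is_perm_mxP[s ->]; rewrite -row_permE; apply/matrixP => i j.
by rewrite !mxE.
Qed.

Lemma friendly_isomorphism_unique A B Pi P : friendly A ->
  is_isomorphism A B Pi -> P *m A = B *m P -> P *m ones = ones -> P = Pi.
Proof.
move=> frA [permPi AE] PA P1.
have [PiTPi PiPiT] := perm_mx_unitary permPi.
have PiT1 : Pi^T *m ones = ones by apply: perm_mx_ones; rewrite is_perm_mx_tr.
suff PiTP : Pi^T *m P = 1%:M by rewrite -[P]mul1mx -PiPiT -mulmxA PiTP mulmx1.
apply: (friendly_commutant frA); last by rewrite -mulmxA P1.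
by rewrite -mulmxA PA AE -!mulmxA (mulmxA Pi) PiPiT mul1mx.
Qed.

(** Each entry of [P] exceeds 1/2 where [Pi] has a 1 and is below 1/2 elsewhere, so [Pi] is the
    strict maximiser of the trace row by row. *)
Lemma perm_projection_near Pi P : is_perm_mx Pi ->
  frobenius_norm (P - Pi) < 2^-1 -> perm_projection P = [set Pi].
Proof.
move=> /is_perm_mxP[s ->] Pnear.
have near_entry i j : `|(P - perm_mx s) i j| < 2^-1.
  apply: le_lt_trans Pnear; rewrite -sqrtr_sqr /frobenius_norm.
  rewrite ler_wsqrtr// (bigD1 i)//= (bigD1 j)//= -addrA lerDl addr_ge0//.
    by apply: sumr_ge0 => k _; exact: sqr_ge0.
  by apply: sumr_ge0 => k _; apply: sumr_ge0 => l _; exact: sqr_ge0.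
have hit i : 2^-1 < P i (s i).
  have := near_entry i (s i); rewrite !mxE eqxx ltr_norml mulr1n => /andP[]; lra.
have miss i j : s i != j -> P i j < 2^-1.
  move=> /negPf sij; have := near_entry i j.
  rewrite !mxE sij subr0 ltr_norml => /andP[]; lra.
have trE (t : {perm 'I_n}) : \tr ((perm_mx t)^T *m P) = \sum_i P i (t i).
  rewrite -[LHS]/(mxdot _ _) mxdotE; apply: eq_bigr => i _.
  rewrite (bigD1 (t i))//= !mxE eqxx mul1r big1 ?addr0// => j /negPf tij.
  by rewrite !mxE eq_sym tij mul0r.
have le_at t i : P i (t i) <= P i (s i).
  have [->//|sti] := eqVneq (s i) (t i).
  by apply/ltW/(lt_trans (miss _ _ sti)).
apply/seteqP; split=> [Q|_ ->] /=.
  move=> [/is_perm_mxP[t ->] /(_ (perm_mx s) (perm_mx_is_perm _ _))].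
  rewrite !trE => les; congr perm_mx; apply/permP => i; apply/eqP.
  apply/negPn/negP; rewrite eq_sym => sti.
  have : \sum_i P i (t i) < \sum_i P i (s i); last by rewrite ltNge les.
  rewrite (bigD1 i)//= [ltRHS](bigD1 i)//=; apply: ltr_leD.
    exact: lt_trans (miss _ _ sti) _.
  by apply: ler_sum => j _.
split; first exact: perm_mx_is_perm.
by move=> Q /is_perm_mxP[t ->]; rewrite !trE; apply: ler_sum => i _.
Qed.

End Friendly.

(** * Limits along ultrafilters and entrywise calculus of matrices *)

Section Convergence.
Set Implicit Arguments.
Unset Strict Implicit.
Context {R : realType}.

(** Compactness of the segment gives a cluster point, and an ultrafilter converges to its cluster
    points. *)
Lemma ultra_bounded_cvg (T : Type) (U : set_system T) (f : T -> R) (a b : R) :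
  UltraFilter U -> U [set t | a <= f t <= b] ->
  exists l : R, f t @[t --> U] --> l.
Proof.
move=> ultraU Uab; have [l [_ lcl]] : exists l, (`[a, b] `&` cluster (f t @[t --> U])) l.
  apply: (@segment_compact _ a b (f t @[t --> U])).
  suff : U (f @^-1` `[a, b]) by [].
  by apply: filterS Uab => t; rewrite /= in_itv/=.
exists l => V Vl; have [//|UV] := in_ultra_setVsetC (f @^-1` V) ultraU.
by have [x [/= xV xV']] := lcl (~` V) V UV Vl.
Qed.

Lemma cvg_mxP (T : Type) (G : set_system T) {FG : Filter G} p q
    (M : T -> 'M[R]_(p, q)) (N : 'M[R]_(p, q)) :
  (forall a b, M t a b @[t --> G] --> N a b) <-> (M t @[t --> G] --> N).
Proof.
split=> [MN V [P PN PV]|MN a b].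
  have : \forall t \near G, forall a b, P a b (M t a b).
    by apply: filter_forall => a; apply: filter_forall => b; exact: MN (PN a b).
  by apply: filterS => t Pt; exact: PV.
by apply: (cvg_comp _ (fun M : 'M[R]_(p, q) => M a b) MN); exact: coord_continuous.
Qed.

Lemma is_derive_mx p q (M : R -> 'M[R]_(p, q)) (N : 'M[R]_(p, q)) (t : R) a b :
  is_derive t 1 M N -> is_derive t 1 (fun s => M s a b) (N a b).
Proof.
move=> [MD MN]; apply: DeriveDef; first by move/derivable_mxP: MD; exact.
by rewrite -MN derive_mx// mxE.
Qed.

End Convergence.

(** * Convergence of solutions to an equilibrium *)

Section Opial.
Set Implicit Arguments.
Unset Strict Implicit.
Context {R : realType} {n : nat}.
Implicit Types (X : R -> state R n) (y : state R n) (t : R).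

Lemma linear_cvg (T : Type) (G : set_system T) {FG : Filter G} l
    (Z : T -> state R n) y : linear_functional l ->
  (forall c, entry (Z t) c @[t --> G] --> entry y c) ->
  l (Z t) @[t --> G] --> l y.
Proof.
move=> [g lE] Zy; apply/subr_cvg0 => /=.
rewrite (_ : (fun _ => _) =
  fun s => \sum_c g c * (entry (Z s) c - entry y c)); last first.
  by apply/funext => s; rewrite !lE -sumrB; apply: eq_bigr => c _; rewrite mulrBr.
have sub := @cvg0_subspace R T G FG; have [_ _ subZ] := sub.
by apply: (subspace_sum sub) => c; apply: subZ; apply/subr_cvg0.
Qed.

Lemma state_cvg_entries X (G : set_system R) {FG : Filter G} y :
  state_cvg X G y <-> (forall c, entry (X t) c @[t --> G] --> entry y c).
Proof.
split=> [Xy|Xy i].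
  apply: (all_entry (Pr := fun l => l (X t) @[t --> G] --> l y)) => i.
  have [? [? [? [? [? [? ?]]]]]] := Xy i.
  by do 6!(split; first by apply/cvg_mxP); apply/cvg_mxP.
have [? [? [? [? [? [? ?]]]]]] :=
  entry_all (Pr := fun l => l (X t) @[t --> G] --> l y) Xy i.
by do 6!(split; first by apply/cvg_mxP); apply/cvg_mxP.
Qed.

Variables (w : 'I_n -> 'I_n -> R) (A B : 'M[R]_n) (H : rel 'I_n).
Hypothesis wC : forall i j, w i j = w j i.
Hypothesis w0 : forall i j, 0 <= w i j.
Hypothesis Hw : forall i j, H i j -> 0 < w i j.
Hypothesis Hconn : forall i j, connect H i j.
Local Notation F := (system_D w A B).

Lemma equilibriumP y : equilibrium w A B y <-> (forall c, entry (F y) c = 0).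
Proof.
split=> [y0|y0 i].
  apply: (all_entry (Pr := fun l => l (F y) = 0)) => i.
  by have [-> [-> [-> [-> [-> [-> ->]]]]]] := y0 i; do !split=> *; rewrite mxE.
have [? [? [? [? [? [? ?]]]]]] := entry_all (Pr := fun l => l (F y) = 0) y0 i.
by do 6!(split; first by apply/matrixP => a b; rewrite [RHS]mxE);
  apply/matrixP => a b; rewrite [RHS]mxE.
Qed.

Lemma trajectory_solution X : trajectory w A B X -> solution w A B X.
Proof.
move=> [_ XD] t c t0; have Xt := XD t t0.
apply: (all_entry (Pr := fun l => is_derive t 1 (fun s => l (X s)) (l (F (X t))))).
move=> i; have [? [? [? [? [? [? ?]]]]]] := Xt i.
by do 6!(split; first by move=> a b; exact: is_derive_mx);
  move=> a b; exact: is_derive_mx.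
Qed.

Lemma linear_P_ones i a b :
  linear_functional (fun x : state R n => (sP x i *m ones) a b).
Proof.
have [lP _] := entry_all (@linear_entry R n) i.
exact: (entries_mulr linear_subspace ones lP a b).
Qed.

(** The projected velocity annihilates [ones], so [P_i 1] is constant; right-continuity at 0 carries
    over the initial value. *)
Lemma trajectory_Dn X i t : trajectory w A B X -> Dn (sP (X 0) i) -> 0 < t ->
  Dn (sP (X t) i).
Proof.
move=> trX X0 t0; apply/matrixP => a b.
have solX := trajectory_solution trX.
apply: (derive0_const (f := fun t => (sP (X t) i *m ones) a b)) t0.
  move=> u u0; have := linear_is_derive (linear_P_ones i a b) solX u0.
  by rewrite projD_ones mxE.
rewrite (_ : (ones : 'cV[R]_n) a b = (sP (X 0) i *m ones) a b); last by rewrite X0.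
apply: (linear_cvg (linear_P_ones i a b)).
by apply/state_cvg_entries; have [] := trX.
Qed.

Lemma tangent_solution_sub X y : solution w A B X ->
  (forall t i, 0 < t -> Dn (sP (X t) i)) ->
  equilibrium w A B y -> (forall i, Dn (sP y i)) ->
  tangent_solution w A B (fun t => state_sub (X t) y).
Proof.
move=> solX X1 /equilibriumP y0 y1; split=> [|t t0 i]; first exact: solution_sub.
apply/matrixP => a b; rewrite (linear_sub _ _ (linear_P_ones i a b)).
by rewrite X1// y1 subrr mxE.
Qed.

(* Opial's argument: the distance to any equilibrium is nonincreasing, so a
   cluster point that is itself an equilibrium must be the limit. *)
Lemma solution_cvg X y0 : solution w A B X ->
  (forall t i, 0 < t -> Dn (sP (X t) i)) ->
  equilibrium w A B y0 -> (forall i, Dn (sP y0 i)) ->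
  exists y, [/\ equilibrium w A B y, forall i, Dn (sP y i) & state_cvg X +oo y].
Proof.
move=> solX X1 eq0 y01; have solD := tangent_solution_sub solX X1 eq0 y01.
(* An ultrafilter finer than [+oo] makes all bounded coordinates converge at once, in place of a
   subsequence. *)
have [U [ultraU yU]] := ultraFilterLemma (@proper_pinfty_nbhs R).
pose D t := state_sub (X t) y0; set E := state_dot (D 1) (D 1).
have U1 : U [set t | 1 < t] by apply: yU; exact: nbhs_pinfty_gt.
have /choice[l lD] c : exists l : R, entry (D t) c @[t --> U] --> l.
  apply: (@ultra_bounded_cvg _ _ _ _ (- (1 + E)) (1 + E)).
  apply: filterS U1 => t /= /ltW t1.
  have := energy_anti wC w0 solD ltr01 t1; rewrite -/(D t) -/E.
  have := sqr_entry_le (D t) c.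
  move: (entry _ _) (state_dot _ _) => x e xe eE.
  by apply/andP; split; nra.
pose y := of_entries (fun c => entry y0 c + l c).
have Xy c : entry (X t) c @[t --> U] --> entry y c.
  rewrite of_entriesK.
  rewrite (_ : (fun _ => _) = fun t => entry y0 c + entry (D t) c).
    by apply: cvgD => //; exact: cvg_cst.
  by apply/funext => t; rewrite entry_sub addrC subrK.
have yeq : equilibrium w A B y.
  apply/equilibriumP => c.
  have F0 : entry (F (X t)) c @[t --> U] --> 0.
    have := system_vanishing wC w0 Hw Hconn c solD.
    rewrite /vanishing (_ : (fun _ => _) = fun t => entry (F (X t)) c).
      by move=> F0 V /F0/yU.
    apply/funext => t; rewrite (linear_sub _ _ (linear_system w A B c)).
    by move/equilibriumP : eq0 => ->; rewrite subr0.
  exact: (cvg_unique _ (linear_cvg (linear_system w A B c) Xy) F0).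
have y1 i : Dn (sP y i).
  apply/matrixP => a b.
  suff lim1 : (sP (X t) i *m ones) a b @[t --> U] --> (ones : 'cV[R]_n) a b.
    exact: (cvg_unique _ (linear_cvg (linear_P_ones i a b) Xy) lim1).
  apply: cvg_near_cst; apply: filterS U1 => t /= t1.
  by rewrite X1//; exact: lt_trans t1.
exists y; split=> //.
(* The energy is now measured from the cluster point [y] instead of [y0]; a single late time at
   which it is small controls all later times. *)
have solE := tangent_solution_sub solX X1 yeq y1.
have E0 : state_dot (state_sub (X t) y) (state_sub (X t) y) @[t --> U] --> 0.
  have sub : fun_subspace (fun f : R -> R => f t @[t --> U] --> 0).
    exact: cvg0_subspace.
  apply: (subspace_sum sub) => c.
  have d0 : entry (state_sub (X t) y) c @[t --> U] --> 0.
    by under eq_fun do rewrite entry_sub; apply/subr_cvg0.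
  by rewrite -[X in _ --> X](mulr0 0); exact: cvgM.
apply/state_cvg_entries => c; apply/subr_cvg0 => /=.
apply: (@vanishing_sqr_le R _ _ 1 _ ltr01).
  2: by move=> t _; rewrite mul1r -entry_sub; exact: sqr_entry_le.
apply/cvgr0Pnorm_le => e e0; move/cvgr0Pnorm_le : E0 => /(_ e e0) Ue.
have [s [/= se s1]] := filter_ex (filterI Ue U1).
exists s; split; first exact: num_real.
move=> t /ltW st; rewrite ger0_norm ?state_dot_ge0//.
apply: le_trans (energy_anti wC w0 solE (lt_trans ltr01 s1) st) _.
exact: le_trans (ler_norm _) se.
Qed.

End Opial.

(** * Existence of an equilibrium and its P-components *)

Section Equilibria.
Set Implicit Arguments.
Unset Strict Implicit.
Context {R : realType} {n : nat}.
Implicit Types (y : state R n) (M P Pi : 'M[R]_n).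

Lemma sum_only_col M : \sum_i only_col i (col i M) = M.
Proof.
apply/matrixP => a b; rewrite summxE (bigD1 b)//= !mxE eqxx big1 ?addr0//.
by move=> i /negPf ib; rewrite mxE eq_sym ib.
Qed.

Lemma sum_only_row M : \sum_i only_row i (row i M)^T = M.
Proof.
apply/matrixP => a b; rewrite summxE (bigD1 a)//= !mxE eqxx big1 ?addr0//.
by move=> i /negPf ib; rewrite mxE eq_sym ib.
Qed.

Variables (w : 'I_n -> 'I_n -> R) (A B : 'M[R]_n) (H : rel 'I_n).
Hypothesis wC : forall i j, w i j = w j i.
Hypothesis w0 : forall i j, 0 <= w i j.
Hypothesis Hw : forall i j, H i j -> 0 < w i j.
Hypothesis Hconn : forall i j, connect H i j.
Hypothesis BT : B^T = B.
Local Notation F := (system_D w A B).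

Lemma disagreement_cst (M : 'I_n -> 'M[R]_n) i : (forall j, M i = M j) ->
  disagreement w M i = 0.
Proof. by move=> ME; apply: big1 => j _; rewrite (ME j) subrr scaler0. Qed.

Lemma col_tr_mul M i : (col i B)^T *m M = row i (B *m M).
Proof. by rewrite tr_col BT row_mul. Qed.

(** All agents hold [Pi], the multipliers are 0, and y and z make the residuals vanish. Only the
    Upsilon equation remains: it asks for a K with a prescribed disagreement, whose sum over agents
    is [Pi *m A - B *m Pi = 0]. *)
Lemma equilibrium_exists Pi : Pi *m A = B *m Pi -> Pi *m ones = ones ->
  exists y, [/\ equilibrium w A B y, forall i, Dn (sP y i),
    forall i, res_y A y i = 0 & forall i, res_z B y i = 0].
Proof.
move=> PiA Pi1.
have [|K KE] := disagreement_solvable wC w0 Hw Hconn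
  (G := fun i => only_col i (col i (Pi *m A)) - only_row i (row i (B *m Pi))^T).
  by rewrite sumrB sum_only_col sum_only_row PiA subrr.
pose y := State (fun=> Pi) K (fun=> 0) (fun=> 0) (fun i => col i (Pi *m A))
  (fun i => (row i (B *m Pi))^T) (fun=> 0).
have ry i : res_y A y i = 0 by rewrite /res_y /= colE colE mulmxA subrr.
have rz i : res_z B y i = 0 by rewrite /res_z /= col_tr_mul trmxK subrr.
exists y; split=> // i.
rewrite /system_D /= ry rz KE !disagreement_cst// subrr !subr0 !trmx0.
do !split=> //.
- by rewrite mul0mx !mulmx0 !subr0 oppr0 /projD mul0mx.
- by rewrite col0 subr0.
- by rewrite row0 !addr0 trmx0.
Qed.

Lemma equilibrium_P_eq y Pi : friendly A -> is_isomorphism A B Pi ->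
  equilibrium w A B y -> (forall i, Dn (sP y i)) -> forall i, sP y i = Pi.
Proof.
move=> frA isoPi yeq y1 i.
have [y0 [y0eq y01 ry0 rz0]] :=
  equilibrium_exists (isomorphism_commute isoPi) (perm_mx_ones isoPi.1).
pose d := state_sub y y0.
have td : tangent d.
  move=> j; apply/matrixP => a b; rewrite (linear_sub _ _ (linear_P_ones j a b)).
  by rewrite y1 y01 subrr mxE.
(* By linearity the field vanishes at the difference [d] of two equilibria, and the energy identity
   then kills its dissipation. *)
have dissd : dissipation w A B d = 0.
  apply/oppr_inj; rewrite -(energy_identity A B wC td) oppr0.
  apply: big1 => c _; rewrite (linear_sub _ _ (linear_system w A B c)).
  move/equilibriumP : yeq => ->; move/equilibriumP : y0eq => ->.
  by rewrite subrr mulr0.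
(* The equilibrium equation for y only equates this residual with a column of Upsilon; that it is 0
   comes from the dissipation of [d]. *)
have ry j : res_y A y j = 0.
  rewrite -(ry0 j); apply/matrixP => a b; apply/subr0_eq.
  rewrite -(linear_sub _ _ ((linear_parts A B j).1 a b)) ord1.
  have [_ + _ _ _] := dissipation_bounds A B wC w0 d j j a a.
  by rewrite dissd => le0; apply/eqP; rewrite -sqrf_eq0 eq_le le0 sqr_ge0.
have rz j : res_z B y j = 0.
  by have [_ [_ [_ [_ [_ [_ /(congr1 trmx)]]]]]] := yeq j; rewrite /= trmxK trmx0.
have PE j k : sP y j = sP y k.
  by apply: (disagreement_eq0 wC w0 Hw Hconn) => l; have [_ [_ [PT _]]] := yeq l.
apply: (friendly_isomorphism_unique frA isoPi); last exact: y1.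
(* Summing the Upsilon equation over the agents removes the Laplacian terms; what is left will read
   [P A = B P]. *)
have UE : \sum_j (only_col j (sy y j) - only_row j (sz y j)) = 0.
  have : \sum_j sUpsilon (F y) j = 0.
    by apply: big1 => j _; have [_ [_ [_ [UE _]]]] := yeq j.
  by rewrite /= !sumrB !sum_disagreement// !subr0.
have yE j : sy y j = col j (sP y i *m A).
  by have /subr0_eq <- := ry j; rewrite (PE j i) !colE mulmxA.
have zE j : sz y j = (row j (B *m sP y i))^T.
  by apply: trmx_inj; have /subr0_eq <- := rz j; rewrite (PE j i) col_tr_mul trmxK.
apply/subr0_eq; rewrite -UE.
under [RHS]eq_bigr do rewrite yE zE.
by rewrite sumrB sum_only_col sum_only_row.
Qed.

End Equilibria.

(** * Convergence of trajectories and recovery of the permutation in finite time *)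

Theorem theorem2 (R : realType) (n : nat) (A B Pistar : 'M[R]_n)
    (H : rel 'I_n) (w : 'I_n -> 'I_n -> R) (Q : R -> state R n)
    (adjA : is_adjacency A) (adjB : is_adjacency B)
    (isoAB : isomorphic A B)
    (asymA : asymmetric A) (asymB : asymmetric B)
    (friendlyA : friendly A) (friendlyB : friendly B)
    (isoPistar : is_isomorphism A B Pistar)
    (graphH : is_connected_weighted_graph H w)
    (trajQ : trajectory w A B Q)
    (initQ : forall i, Dn (sP (Q 0) i)) :
  (exists2 Qinf : state R n,
     equilibrium w A B Qinf & state_cvg Q +oo Qinf) /\
  (forall i, sP (Q t) i @[t --> +oo] --> Pistar) /\
  (exists2 T : R, 0 < T &
     forall t, T <= t -> forall i,
       frobenius_norm (sP (Q t) i - Pistar) < 2^-1 /\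
       perm_projection (sP (Q t) i) = [set Pistar]).
Proof.
have [_ Hconn wC Hw Hw0] := graphH.
have w0 i j : 0 <= w i j.
  by have [/Hw/ltW|/Hw0 ->] := boolP (H i j).
have [BT _] := adjB; have permPi := isoPistar.1.
have [y0 [y0eq y01 _ _]] := equilibrium_exists wC w0 Hw Hconn BT
  (isomorphism_commute isoPistar) (perm_mx_ones permPi).
have Q1 t i : 0 < t -> Dn (sP (Q t) i) by exact: (trajectory_Dn trajQ).
have [y [yeq y1 Qy]] :=
  solution_cvg wC w0 Hw Hconn (trajectory_solution trajQ) Q1 y0eq y01.
have yP := equilibrium_P_eq wC w0 Hw Hconn BT friendlyA isoPistar yeq y1.
have QP i : sP (Q t) i @[t --> +oo] --> Pistar by rewrite -(yP i); have [] := Qy i.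
split; first by exists y.
split=> //.
have [T [_ nearT]] : \forall t \near +oo, forall i,
    frobenius_norm (sP (Q t) i - Pistar) < 2^-1.
  apply: filter_forall => i.
  have sub := @vanishing_subspace R.
  pose f t := \sum_a \sum_b (sP (Q t) i - Pistar) a b ^+ 2.
  have f0 : vanishing f.
    apply: (subspace_sum sub) => a; apply: (subspace_sum sub) => b.
    have e0 : vanishing (fun t => (sP (Q t) i - Pistar) a b).
      under eq_fun do rewrite !mxE; apply/subr_cvg0.
      by apply: (cvg_mxP _ _).2; exact: QP.
    by rewrite /vanishing -[X in _ --> X](mulr0 0); exact: cvgM.
  have e0 : 0 < 2^-1 ^+ 2 :> R by rewrite exprn_gt0// invr_gt0.
  move/cvgr0Pnorm_lt : f0 => /(_ _ e0); apply: filterS => t ft.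
  rewrite /frobenius_norm -(ltr_pXn2r (n := 2))// ?nnegrE// ?sqrtr_ge0// ?invr_ge0//.
  rewrite sqr_sqrtr; first exact: le_lt_trans (ler_norm _) ft.
  by apply: sumr_ge0 => a _; apply: sumr_ge0 => b _; exact: sqr_ge0.
(* The maximum with 0 and the added 1 make the time positive and strictly larger than [T], as the
   neighbourhood of [+oo] requires. *)
exists (Num.max 0 T + 1); first by rewrite ltr_wpDl// le_max lexx.
move=> t Tt i; have /nearT/(_ i) Qnear : T < t.
  apply: lt_le_trans Tt; rewrite ltr_pwDr// le_max lexx orbT//.
by split=> //; exact: perm_projection_near.
Qed.
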